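(* Fix $j\in\{1,2\}$. Let $h_1,\dots,h_{m'}$ be twice continuously differentiable. Suppose the following conditions hold: 1. $f_0(z),f_j(z),g_{0,k}(z),g_{j,k}(z)$ for $k=1,\dots,m$ are twice continuously differentiable. 2. The problem $\min_{z\in\mathcal Z_j(0)}f_0(z)$ has a unique minimizer $z_0$ over $\mathcal Z_j(0)$. 3. (Inf-compactness) There exist constants $\alpha$ and $t_0>0$ such that the constrained level set $\{z\in\mathcal Z_j(t): f_0(z)+t(f_j(z)-f_0(z))\le\alpha\}$ is nonempty and uniformly bounded over $t\in[0,t_0)$. 4. $z_0$ is associated with a unique Lagrangian multiplier $(\lambda_0,\nu_0)$, which also satisfies strict complementarity: $\lambda_{0,k}>0$ if $k\in K_g(z_0)$ and $\nu_{0,k'}>0$ if $k'\in K_h(z_0)$, where $K_g(z_0)=\{k:g_{0,k}(z_0)=0,\ k=s+1,\dots,m\}$ and $K_h(z_0)=\{k':h_{k'}(z_0)=0,\ k'=s'+1,\dots,m'\}$. 5. (Mangasarian-Fromovitz) $\nabla g_{0,k}(z_0)$, $k=1,\dots,s$, are linearly independent; $\nabla h_{k'}(z_0)$, $k'=1,\dots,s'$, are linearly independent; and there exists $d_z$ with $\nabla g_{0,k}(z_0)^\top d_z=0$ for $k=1,\dots,s$, $\nabla g_{0,k}(z_0)^\top d_z<0$ for $k\in K_g(z_0)$, $\nabla h_{k'}(z_0)^\top d_z=0$ for $k'=1,\dots,s'$, and $\nabla h_{k'}(z_0)^\top d_z<0$ for $k'\in K_h(z_0)$. 6. (Second order sufficient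 condition) $d_z^\top\nabla^2_{zz}\mathcal L(z_0;\lambda_0,\nu_0)d_z>0$ for all $d_z\in C(z_0)\setminus\{0\}$, where $\mathcal L(z;\lambda,\nu)=f_0(z)+\sum_{k=1}^m\lambda_kg_{0,k}(z)+\sum_{k'=1}^{m'}\nu_{k'}h_{k'}(z)$ and $C(z_0)$ is the set of $d_z$ such that $d_z^\top\nabla g_{0,k}(z_0)=0$ for $k\in\{1,\dots,s\}\cup K_g(z_0)$ and $d_z^\top\nabla h_{k'}(z_0)=0$ for $k'\in\{1,\dots,s'\}\cup K_h(z_0)$. Then, as $t\downarrow0$, $$v_j(t)=(1-t)f_0(z_0)+tf_j(z_0)+t\lambda_0^\top(\mathcal G_j(z_0)-\mathcal G_0(z_0))+\tfrac12t^2\Big\{d_z^{j*\top}\nabla^2_{zz}\mathcal L(z_0;\lambda_0,\nu_0)d_z^{j*}+2d_z^{j*\top}\big(\nabla f_j(z_0)-\nabla f_0(z_0)+(\nabla\mathcal G_j^\top(z_0)-\nabla\mathcal G_0^\top(z_0))\lambda_0\big)\Big\}+o(t^2),$$ $$z_j(t)=z_0+t\,d_z^{j*}+o(t),$$ where $d_z^{j*}$ is the first part of the unique solution $(d_z^j,\xi,\eta)$ of $$\begin{bmatrix} \nabla^2_{zz}\mathcal L(z_0;\lambda_0,\nu_0) & A^\top & B^\top \\ A & 0 & 0 \\ B & 0 & 0 \end{bmatrix}\begin{bmatrix} d_z^j \\ \xi \\ \eta \end{bmatrix}=\begin{bmatrix} -(\nabla f_j(z_0)-\nabla f_0(z_0))-(\nabla\mathcal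 G_j^\top(z_0)-\nabla\mathcal G_0^\top(z_0))\lambda_0 \\ -(\mathcal G_j^{K_g}(z_0)-\mathcal G_0^{K_g}(z_0)) \\ 0 \end{bmatrix}.$$
   Context: $(X,Y)$ is a random pair with $X\in\mathbb R^p$, $Y\in\mathcal Y$; $c(z;y)$ and $G_k(z;y)$, $k=1,\dots,m$, are real-valued functions of $z\in\mathbb R^d$ and $y\in\mathcal Y$; $h_{k'}:\mathbb R^d\to\mathbb R$, $k'=1,\dots,m'$, are known functions. $R_0\subseteq\mathbb R^p$ is a region with subpartition $R_0=R_1\cup R_2$, $R_1\cap R_2=\varnothing$. For $j=0,1,2$: $f_j(z)=\mathbb E[c(z;Y)\mid X\in R_j]$, $g_{j,k}(z)=\mathbb E[G_k(z;Y)\mid X\in R_j]$. For $j=1,2$ and $t\in[0,1]$, $$\mathcal Z_j(t)=\Big\{z\in\mathbb R^d:\ g_{0,k}(z)+t(g_{j,k}(z)-g_{0,k}(z))=0\ (k=1,\dots,s),\ g_{0,k}(z)+t(g_{j,k}(z)-g_{0,k}(z))\le0\ (k=s+1,\dots,m),\ h_{k'}(z)=0\ (k'=1,\dots,s'),\ h_{k'}(z)\le0\ (k'=s'+1,\dots,m')\Big\},$$ $v_j(t)=\min_{z\in\mathcal Z_j(t)}\{f_0(z)+t(f_j(z)-f_0(z))\}$, and $z_j(t)$ is any element of the corresponding argmin. A Lagrangian multiplier associated with $z_0$ is a pair $(\lambda,\nu)\in\mathbb R^m\times\mathbb R^{m'}$ with $\nabla_z\mathcal L(z_0;\lambda,\nu)=0$,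 $\lambda_k\ge0$ and $\lambda_kg_{0,k}(z_0)=0$ for $k>s$, $\nu_{k'}\ge0$ and $\nu_{k'}h_{k'}(z_0)=0$ for $k'>s'$. $\mathcal G_j(z_0)\in\mathbb R^m$ is the column vector with entries $g_{j,k}(z_0)$; $\mathcal G_j^{K_g}(z_0)$ is its subvector with indices in $\{1,\dots,s\}\cup K_g(z_0)$; $\nabla\mathcal G_j^\top(z_0)$ is the $d\times m$ matrix with columns $\nabla g_{j,k}(z_0)$. $A$ is the matrix with rows $\nabla g_{0,k}(z_0)^\top$, $k\in\{1,\dots,s\}\cup K_g(z_0)$, and $B$ the matrix with rows $\nabla h_{k'}(z_0)^\top$, $k'\in\{1,\dots,s'\}\cup K_h(z_0)$. *)

(* Defs.v *)
From mathcomp Require Export all_boot all_order all_algebra.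
From mathcomp Require Export all_classical all_reals all_analysis.
Set Implicit Arguments.
Unset Strict Implicit.
Unset Printing Implicit Defensive.
Import Order.TTheory GRing.Theory Num.Theory.
Import numFieldNormedType.Exports.
Local Open Scope classical_set_scope.
Local Open Scope ring_scope.

(* E[W | E] for an event E; meaningful when 0 < P E and W is integrable on E. *)
Definition cond_mean (R : realType) (dT : measure_display)
    (T : measurableType dT) (P : probability T R) (E : set T) (W : T -> R) : R :=
  (\int[P]_(w in E) W w) / fine (P E).

Definition dotv (R : realType) (d : nat) (u v : 'cV[R]_d) : R :=
  (u^T *m v) 0 0.

Definition partial (R : realType) (d : nat) (F : 'cV[R]_d -> R) (i : 'I_d)
    (z : 'cV[R]_d) : R :=
  'D_(delta_mx i 0 : 'cV[R]_d) F z.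

Definition grad (R : realType) (d : nat) (F : 'cV[R]_d -> R) (z : 'cV[R]_d) :
    'cV[R]_d :=
  \col_i partial F i z.

Definition hess (R : realType) (d : nat) (F : 'cV[R]_d -> R) (z : 'cV[R]_d) :
    'M[R]_d :=
  \matrix_(i, l) partial (partial F i) l z.

(* Continuity of F and of its first partials follows from differentiability. *)
Definition C2 (R : realType) (d : nat) (F : 'cV[R]_d -> R) : Prop :=
  [/\ forall z, differentiable F z,
      forall i z, differentiable (partial F i) z &
      forall i l, continuous (partial (partial F i) l)].

Definition interp (R : realType) (d : nat) (F0 Fj : 'cV[R]_d -> R) (t : R)
    (z : 'cV[R]_d) : R :=
  F0 z + t * (Fj z - F0 z).

(* Indices are 0-based throughout: k < s are the equality constraints. *)
Definition feasible (R : realType) (d m m' s s' : nat)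
    (g0 gj : 'I_m -> 'cV[R]_d -> R) (h : 'I_m' -> 'cV[R]_d -> R) (t : R) :
    set 'cV[R]_d :=
  [set z | [/\ forall k : 'I_m, (k < s)%N -> interp (g0 k) (gj k) t z = 0,
               forall k : 'I_m, (s <= k)%N -> interp (g0 k) (gj k) t z <= 0,
               forall k : 'I_m', (k < s')%N -> h k z = 0 &
               forall k : 'I_m', (s' <= k)%N -> h k z <= 0]].

Definition argmin (R : realType) (E : Type) (F : E -> R) (Z : set E) : set E :=
  [set z | Z z /\ forall y, Z y -> F z <= F y].

(* Equals the minimum whenever [argmin F Z] is nonempty. *)
Definition minval (R : realType) (E : Type) (F : E -> R) (Z : set E) : R :=
  inf (F @` Z).

Definition lagrangian (R : realType) (d m m' : nat) (f0 : 'cV[R]_d -> R)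
    (g0 : 'I_m -> 'cV[R]_d -> R) (h : 'I_m' -> 'cV[R]_d -> R)
    (lam : 'cV[R]_m) (nu : 'cV[R]_m') (z : 'cV[R]_d) : R :=
  f0 z + \sum_k lam k 0 * g0 k z + \sum_k nu k 0 * h k z.

Definition lagrange_multiplier (R : realType) (d m m' s s' : nat)
    (f0 : 'cV[R]_d -> R) (g0 : 'I_m -> 'cV[R]_d -> R)
    (h : 'I_m' -> 'cV[R]_d -> R) (z0 : 'cV[R]_d)
    (lam : 'cV[R]_m) (nu : 'cV[R]_m') : Prop :=
  [/\ grad (lagrangian f0 g0 h lam nu) z0 = 0,
      forall k : 'I_m, (s <= k)%N -> 0 <= lam k 0 /\ lam k 0 * g0 k z0 = 0 &
      forall k : 'I_m', (s' <= k)%N -> 0 <= nu k 0 /\ nu k 0 * h k z0 = 0].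

Definition equality_set (m s : nat) : {set 'I_m} :=
  [set k : 'I_m | (k < s)%N]%SET.

Definition Kset (R : realType) (d m s : nat) (g : 'I_m -> 'cV[R]_d -> R)
    (z0 : 'cV[R]_d) : {set 'I_m} :=
  [set k : 'I_m | (s <= k)%N && (g k z0 == 0)]%SET.

Definition active_set (R : realType) (d m s : nat) (g : 'I_m -> 'cV[R]_d -> R)
    (z0 : 'cV[R]_d) : {set 'I_m} :=
  (equality_set m s :|: Kset s g z0)%SET.

(* Values and gradients (as rows) of the [g k], [k \in K], in increasing order
   of [k]. *)
Definition valv (R : realType) (d m : nat) (K : {set 'I_m})
    (g : 'I_m -> 'cV[R]_d -> R) (z : 'cV[R]_d) : 'cV[R]_#|K| :=
  \col_(i < #|K|) g (enum_val i) z.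

Definition gradmx (R : realType) (d m : nat) (K : {set 'I_m})
    (g : 'I_m -> 'cV[R]_d -> R) (z : 'cV[R]_d) : 'M[R]_(#|K|, d) :=
  \matrix_(i < #|K|, l < d) grad (g (enum_val i)) z l 0.

Definition allvalv (R : realType) (d m : nat) (g : 'I_m -> 'cV[R]_d -> R)
    (z : 'cV[R]_d) : 'cV[R]_m :=
  \col_k g k z.

Definition allgradT (R : realType) (d m : nat) (g : 'I_m -> 'cV[R]_d -> R)
    (z : 'cV[R]_d) : 'M[R]_(d, m) :=
  \matrix_(l, k) grad (g k) z l 0.

Definition inf_compact (R : realType) (d m m' s s' : nat)
    (f0 fj : 'cV[R]_d -> R) (g0 gj : 'I_m -> 'cV[R]_d -> R)
    (h : 'I_m' -> 'cV[R]_d -> R) : Prop :=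
  exists (alpha t0 : R),
    let level t := feasible s s' g0 gj h t
                   `&` [set z | interp f0 fj t z <= alpha] in
    [/\ 0 < t0,
        forall t, 0 <= t < t0 -> level t !=set0 &
        bounded_set (\bigcup_(t in [set t : R | 0 <= t < t0]) level t)].

Definition strict_complementarity (R : realType) (d m m' s s' : nat)
    (g0 : 'I_m -> 'cV[R]_d -> R) (h : 'I_m' -> 'cV[R]_d -> R)
    (z0 : 'cV[R]_d) (lam : 'cV[R]_m) (nu : 'cV[R]_m') : Prop :=
  (forall k, k \in Kset s g0 z0 -> 0 < lam k 0) /\
  (forall k, k \in Kset s' h z0 -> 0 < nu k 0).

Definition mangasarian_fromovitz (R : realType) (d m m' s s' : nat)
    (g0 : 'I_m -> 'cV[R]_d -> R) (h : 'I_m' -> 'cV[R]_d -> R)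
    (z0 : 'cV[R]_d) : Prop :=
  [/\ row_free (gradmx (equality_set m s) g0 z0),
      row_free (gradmx (equality_set m' s') h z0) &
      exists dz : 'cV[R]_d,
        [/\ forall k : 'I_m, (k < s)%N -> dotv (grad (g0 k) z0) dz = 0,
            forall k, k \in Kset s g0 z0 -> dotv (grad (g0 k) z0) dz < 0,
            forall k : 'I_m', (k < s')%N -> dotv (grad (h k) z0) dz = 0 &
            forall k, k \in Kset s' h z0 -> dotv (grad (h k) z0) dz < 0]].

Definition critical_cone (R : realType) (d m m' s s' : nat)
    (g0 : 'I_m -> 'cV[R]_d -> R) (h : 'I_m' -> 'cV[R]_d -> R)
    (z0 : 'cV[R]_d) : set 'cV[R]_d :=
  [set dz | (forall k, k \in active_set s g0 z0 -> dotv dz (grad (g0 k) z0) = 0)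
         /\ (forall k, k \in active_set s' h z0 -> dotv dz (grad (h k) z0) = 0)].

Definition second_order_sufficient (R : realType) (d m m' s s' : nat)
    (f0 : 'cV[R]_d -> R) (g0 : 'I_m -> 'cV[R]_d -> R)
    (h : 'I_m' -> 'cV[R]_d -> R) (z0 : 'cV[R]_d)
    (lam : 'cV[R]_m) (nu : 'cV[R]_m') : Prop :=
  forall dz, critical_cone s s' g0 h z0 dz -> dz != 0 ->
    0 < dotv dz (hess (lagrangian f0 g0 h lam nu) z0 *m dz).

Definition kkt_matrix (R : realType) (d a b : nat) (H : 'M[R]_d)
    (A : 'M[R]_(a, d)) (B : 'M[R]_(b, d)) : 'M[R]_(d + (a + b)) :=
  block_mx H (row_mx A^T B^T) (col_mx A B) 0.

Definition cost_shift (R : realType) (d m : nat) (f0 fj : 'cV[R]_d -> R)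
    (g0 gj : 'I_m -> 'cV[R]_d -> R) (z0 : 'cV[R]_d) (lam : 'cV[R]_m) :
    'cV[R]_d :=
  grad fj z0 - grad f0 z0 + (allgradT gj z0 - allgradT g0 z0) *m lam.

(* Main.v *)
Require Import Defs.
From mathcomp Require Import ring lra.
Set Implicit Arguments.
Unset Strict Implicit.
Unset Printing Implicit Defensive.
Import Order.TTheory GRing.Theory Num.Theory.
Import numFieldNormedType.Exports.
Local Open Scope classical_set_scope.
Local Open Scope ring_scope.

(** The expansion is squeezed between an upper bound, obtained by repairing the
    infeasibility of the tangent line, and a quadratic growth estimate for the
    perturbed problem around that line.

    All constraints are numbered together and those active at [z0] are
    singled out. If the multiplier could move along a linear dependency of the
    active gradients, strict complementarity would keep a short move
    admissible; so uniqueness of the multiplier makes these gradients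
    independent ([unique_multiplier_licq]), and with the second-order condition
    this makes the KKT matrix invertible ([kkt_unit]).

    Let [H] be the Hessian of the Lagrangian, [J] the matrix of active
    gradients, [q] the shift of the cost and [value2 t] the claimed expansion.
    The relaxation [lag + t * dlag] is the perturbed objective plus the
    multipliers times the perturbed constraints; near [z0] it is known to
    second order ([lag_expand]).

    Upper bound: the point [z0 + t dz] violates the active constraints by
    [o(t)] only, and independence of their gradients allows an [o(t)]
    correction that satisfies them exactly ([active_curve]). At the corrected
    point the objective equals the relaxation, which is
    [value2 t + o(t ^ 2)] ([value_upper_bound]).

    Lower bound: write a feasible point near [z0] as [z0 + t dz + w]. The
    objective exceeds the relaxation by the slack of the inequalities weighted
    by the multipliers, which strict complementarity bounds below by a multiple
    of [|C|], with [C] the vector of active constraint values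
    ([slack_bound]). In the relaxation the term linear in [w] is
    [t (H dz + q) . w = - t zeta . J w] by the KKT system, and the term
    quadratic in [w] is positive definite up to a multiple of [|J w| ^ 2]
    ([definite_on_kernel]). As [J w = C + o(t + |w|)], the slack absorbs both,
    and the objective is at least [value2 t + mu |w| ^ 2 - o(t ^ 2)]
    ([quadratic_growth]).

    Minimizers exist by inf-compactness ([argmin_exists]) and tend to [z0]
    ([near_optimal_near_z0]); at a minimizer the two bounds force
    [w = o(t)] and give the value up to [o(t ^ 2)]. *)

(** * Inner product and sup norm of column vectors *)

Lemma dotvE (R : realType) d (u v : 'cV[R]_d) :
  dotv u v = \sum_i u i 0 * v i 0.
Proof. by rewrite /dotv mxE; apply: eq_bigr => i _; rewrite mxE. Qed.

Lemma dotvC (R : realType) d (u v : 'cV[R]_d) : dotv u v = dotv v u.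
Proof. by rewrite !dotvE; apply: eq_bigr => i _; rewrite mulrC. Qed.

Lemma dotvDl (R : realType) d (u v w : 'cV[R]_d) :
  dotv (u + v) w = dotv u w + dotv v w.
Proof. by rewrite /dotv linearD /= mulmxDl mxE. Qed.

Lemma dotvZl (R : realType) d (a : R) (u v : 'cV[R]_d) :
  dotv (a *: u) v = a * dotv u v.
Proof. by rewrite /dotv linearZ /= -scalemxAl mxE. Qed.

Lemma dotv0l (R : realType) d (v : 'cV[R]_d) : dotv 0 v = 0.
Proof. by rewrite -(scale0r 0) dotvZl mul0r. Qed.

Lemma dotvNl (R : realType) d (u v : 'cV[R]_d) : dotv (- u) v = - dotv u v.
Proof. by rewrite -scaleN1r dotvZl mulN1r. Qed.

Lemma dotvDr (R : realType) d (u v w : 'cV[R]_d) :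
  dotv u (v + w) = dotv u v + dotv u w.
Proof. by rewrite dotvC dotvDl !(dotvC u). Qed.

Lemma dotvZr (R : realType) d (a : R) (u v : 'cV[R]_d) :
  dotv u (a *: v) = a * dotv u v.
Proof. by rewrite dotvC dotvZl dotvC. Qed.

Lemma dotvNr (R : realType) d (u v : 'cV[R]_d) : dotv u (- v) = - dotv u v.
Proof. by rewrite dotvC dotvNl dotvC. Qed.

Lemma dotv0r (R : realType) d (v : 'cV[R]_d) : dotv v 0 = 0.
Proof. by rewrite dotvC dotv0l. Qed.

Lemma dotv_delta (R : realType) d (u : 'cV[R]_d) i :
  dotv u (delta_mx i 0) = u i 0.
Proof.
rewrite dotvE (bigD1 i) //= big1 => [|k ki]; rewrite mxE !eqxx /=.
  by rewrite mulr1 addr0.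
by rewrite (negbTE ki) mulr0.
Qed.

Lemma ler_norm_entry (R : realType) m n (A : 'M[R]_(m, n)) i j :
  `|A i j| <= `|A|.
Proof.
rewrite [leRHS]/Num.norm /= mx_normrE.
exact: (le_bigmax_cond 0 (fun ij => `|A ij.1 ij.2|) (j := (i, j))).
Qed.

Lemma ler_mx_norm (R : realType) m n (A : 'M[R]_(m, n)) (c : R) :
  0 <= c -> (forall i j, `|A i j| <= c) -> `|A| <= c.
Proof.
by move=> c0 Ac; rewrite [leLHS]/Num.norm /= mx_normrE; apply/bigmax_leP.
Qed.

Lemma ler_norm_dotv (R : realType) d (u v : 'cV[R]_d) :
  `|dotv u v| <= d%:R * `|u| * `|v|.
Proof.
rewrite dotvE (le_trans (ler_norm_sum _ _ _))//.
have -> : d%:R * `|u| * `|v| = \sum_(i < d) `|u| * `|v|.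
  by rewrite sumr_const card_ord -mulrA mulr_natl.
apply: ler_sum => i _; rewrite normrM.
by apply: ler_pM => //; exact: ler_norm_entry.
Qed.

Lemma dotv_rowE (R : realType) m n (A : 'M[R]_(m, n)) (x : 'cV[R]_n) i :
  (A *m x) i 0 = dotv (row i A)^T x.
Proof. by rewrite mxE dotvE; apply: eq_bigr => j _; rewrite !mxE. Qed.

Lemma ler_norm_mulmx (R : realType) m n (A : 'M[R]_(m, n)) (x : 'cV[R]_n) :
  `|A *m x| <= n%:R * `|A| * `|x|.
Proof.
apply: ler_mx_norm => [|i j]; first by rewrite !mulr_ge0.
rewrite ord1 dotv_rowE (le_trans (ler_norm_dotv _ _))//.
rewrite ler_wpM2r// ler_wpM2l//; apply: ler_mx_norm => // k l.
by rewrite !mxE; exact: ler_norm_entry.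
Qed.

Lemma dotv_mulmx_sym (R : realType) d (A : 'M[R]_d) (x y : 'cV[R]_d) :
  A^T = A -> dotv x (A *m y) = dotv y (A *m x).
Proof.
move=> symA; rewrite dotvC /dotv trmx_mul symA -mulmxA.
by [].
Qed.

Lemma cV_sum_delta (R : realType) d (v : 'cV[R]_d) :
  v = \sum_i v i 0 *: delta_mx i 0.
Proof.
by rewrite {1}(matrix_sum_delta v); apply: eq_bigr => i _; rewrite big_ord1.
Qed.

Lemma derive_grad (R : realType) d (F : 'cV[R]_d -> R) z v :
  differentiable F z -> 'D_v F z = dotv (grad F z) v.
Proof.
move=> dF; rewrite deriveE// {1}[v]cV_sum_delta linear_sum/= dotvE.
apply: eq_bigr => i _; rewrite linearZ/= mxE /partial deriveE//.
by rewrite mulrC.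
Qed.

Lemma is_derive_line (R : realType) d (F : 'cV[R]_d -> R) a v s :
  differentiable F (a + s *: v) ->
  is_derive s (1 : R) (fun s => F (a + s *: v))
    (dotv (grad F (a + s *: v)) v).
Proof.
move=> dF; rewrite -derive_grad//.
have da : differentiable (fun s : R => a + s *: v) s by [].
have dc : differentiable (F \o (fun s : R => a + s *: v)) s.
  exact: differentiable_comp.
apply: DeriveDef; first exact/diff_derivable.
rewrite deriveE// diff_comp//= deriveE//.
congr ('d F _ _).
have D : is_diff s (cst a + *:%R^~ v) (0 + *:%R^~ v).
  exact: is_diffD.
have -> : (fun s : R => a + s *: v) = cst a + *:%R^~ v by [].
rewrite (@diff_val _ _ _ _ _ _ _ D).
by change (0 + 1 *: v = v); rewrite add0r scale1r.
Qed.

(** * First- and second-order expansions *)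

Lemma mvt_line (R : realType) d (F : 'cV[R]_d -> R) a v :
  (forall z, differentiable F z) ->
  exists2 c : R, 0 < c < 1 & F (a + v) - F a = dotv (grad F (a + c *: v)) v.
Proof.
move=> dF.
have dline s := is_derive_line (dF (a + s *: v)).
have [|c c01] := @MVT R (fun s => F (a + s *: v))
  (fun s => dotv (grad F (a + s *: v)) v) 0 1 ltr01 (fun s _ => dline s).
  apply: derivable_within_continuous => s _.
  exact: (@ex_derive _ _ _ _ _ _ _ (dline s)).
rewrite scale1r scale0r addr0 subr0 mulr1 => E.
by exists c => //; rewrite in_itv/= in c01.
Qed.

Definition C1 (R : realType) d (F : 'cV[R]_d -> R) : Prop :=
  (forall z, differentiable F z) /\ (forall i, continuous (partial F i)).

Lemma C2_C1 (R : realType) d (F : 'cV[R]_d -> R) : C2 F -> C1 F.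
Proof.
by case=> dF dpF _; split=> // i z; exact/differentiable_continuous/dpF.
Qed.

Lemma C2_C1_partial (R : realType) d (F : 'cV[R]_d -> R) i :
  C2 F -> C1 (partial F i).
Proof. by case=> _ dpF cpF; split=> // l z; exact: cpF. Qed.

Lemma C1_continuous (R : realType) d (F : 'cV[R]_d -> R) :
  C1 F -> continuous F.
Proof. by case=> dF _ z; exact: differentiable_continuous. Qed.

Lemma C2_continuous (R : realType) d (F : 'cV[R]_d -> R) :
  C2 F -> continuous F.
Proof. by move/C2_C1/C1_continuous. Qed.

Lemma near_ball_ex (R : realType) (V : normedModType R) (z0 : V)
    (Q : V -> Prop) :
  (\forall z \near z0, Q z) ->
  exists2 r : R, 0 < r & forall z, `|z - z0| < r -> Q z.
Proof.
move=> /nbhs_ballP[r r0 rQ]; exists r => // z zr; apply: rQ.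
by rewrite -ball_normE /= distrC.
Qed.

Lemma forall_ball_ex (R : realType) (V : normedModType R) (z0 : V)
    (I : finType) (Q : I -> V -> Prop) :
  (forall i, exists2 r : R, 0 < r & forall z, `|z - z0| < r -> Q i z) ->
  exists2 r : R, 0 < r & forall z, `|z - z0| < r -> forall i, Q i z.
Proof.
move=> rQ; apply: near_ball_ex; apply: (@filter_forall _ _ Q) => i.
have [r r0 {}rQ] := rQ i.
apply/nbhs_ballP; exists r => // x; rewrite -ball_normE /= distrC; exact: rQ.
Qed.

Lemma grad_continuous_at (R : realType) d (F : 'cV[R]_d -> R) z0 (e : R) :
  C1 F -> 0 < e ->
  exists2 r, 0 < r & forall z, `|z - z0| < r ->
    `|grad F z - grad F z0| <= e.
Proof.
move=> [_ cF] e0.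
have [i|r r0 rF] := @forall_ball_ex _ _ z0 'I_d
    (fun i z => `|partial F i z - partial F i z0| <= e).
  apply: near_ball_ex; have /cvgrPdist_le := cF i z0.
  by move=> /(_ _ e0); apply: filterS => z; rewrite distrC.
exists r => // z /rF zF; apply: ler_mx_norm; first exact: ltW.
by move=> i l; rewrite !mxE; exact: zF.
Qed.

Lemma segment_in_ball (R : realType) (V : normedModType R) (z0 x y : V)
    (r c : R) :
  0 < c < 1 -> `|x - z0| < r -> `|y - z0| < r -> `|y + c *: (x - y) - z0| < r.
Proof.
move=> /andP[c0 c1] xr yr.
have -> : y + c *: (x - y) - z0 = c *: (x - z0) + (1 - c) *: (y - z0).
  have -> : x - y = (x - z0) - (y - z0) by rewrite opprB subrKA.
  by rewrite scalerBr scalerBl scale1r addrAC addrCA.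
rewrite (le_lt_trans (ler_normD _ _))// !normrZ !gtr0_norm ?subr_gt0//.
nra.
Qed.

Lemma mulr_divS_le (R : realType) (d : nat) (e : R) :
  0 <= e -> d%:R * (e / d.+1%:R) <= e.
Proof.
move=> e0; rewrite mulrCA ler_piMr// ler_pdivrMr// mul1r ler_nat.
exact: leqnSn.
Qed.

(** Between two variable points, not only at [z0]: this is what makes the
    corrector map of [active_curve] a contraction. *)
Lemma strictly_differentiable (R : realType) d (F : 'cV[R]_d -> R) z0 (e : R) :
  C1 F -> 0 < e ->
  exists2 r, 0 < r & forall x y, `|x - z0| < r -> `|y - z0| < r ->
    `|F x - F y - dotv (grad F z0) (x - y)| <= e * `|x - y|.
Proof.
move=> cF e0.
have e'0 : 0 < e / d.+1%:R by rewrite divr_gt0.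
have [r r0 rF] := grad_continuous_at z0 cF e'0.
exists r => // x y xr yr.
have [c c01] := mvt_line y (x - y) cF.1.
rewrite (addrC y) subrK => ->.
rewrite -dotvNl -dotvDl (le_trans (ler_norm_dotv _ _))// ler_wpM2r//.
have /rF := segment_in_ball c01 xr yr.
move=> /(ler_wpM2l (ler0n R d)) /le_trans; apply.
exact/mulr_divS_le/ltW.
Qed.

Lemma partial_grad_hess (R : realType) d (F : 'cV[R]_d -> R) z i v :
  dotv (grad (partial F i) z) v = (hess F z *m v) i 0.
Proof. by rewrite dotvE mxE; apply: eq_bigr => l _; rewrite !mxE. Qed.

(** The remainder along the segment, minus its quadratic model, has derivative
    [(grad F (z0 + s v) - grad F z0 - s H v) . v], which is [o(|v| ^ 2)]
    because the gradient is differentiable at [z0]; the mean value theorem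
    transfers this bound to the remainder. *)
Lemma taylor2 (R : realType) d (F : 'cV[R]_d -> R) z0 (e : R) :
  C2 F -> 0 < e ->
  exists2 r, 0 < r & forall z, `|z - z0| < r ->
    `|F z - F z0 - dotv (grad F z0) (z - z0)
      - 2^-1 * dotv (z - z0) (hess F z0 *m (z - z0))| <= e * `|z - z0| ^+ 2.
Proof.
move=> cF e0; have [dF _ _] := cF.
have e'0 : 0 < e / d.+1%:R by rewrite divr_gt0.
have [r r0 rF] : exists2 r, 0 < r & forall x, `|x - z0| < r ->
    `|grad F x - grad F z0 - hess F z0 *m (x - z0)|
      <= e / d.+1%:R * `|x - z0|.
  have [i|r r0 rF] := @forall_ball_ex _ _ z0 'I_d (fun i x =>
     `|partial F i x - partial F i z0
       - dotv (grad (partial F i) z0) (x - z0)| <= e / d.+1%:R * `|x - z0|).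
    have [r r0 rF] := strictly_differentiable z0 (C2_C1_partial i cF) e'0.
    by exists r => // x xr; apply: rF => //; rewrite subrr normr0.
  exists r => // x /rF xF; apply: ler_mx_norm => [|i j].
    by rewrite mulr_ge0// ltW.
  have := xF i; rewrite partial_grad_hess.
  by rewrite ord1 !mxE.
exists r => // z zr; set v := z - z0; set H := hess F z0.
pose psi s := F (z0 + s *: v) - s * dotv (grad F z0) v
                - s ^+ 2 * (2^-1 * dotv v (H *m v)).
pose dpsi s := dotv (grad F (z0 + s *: v)) v - dotv (grad F z0) v
                - s * dotv v (H *m v).
have dline s := is_derive_line (dF (z0 + s *: v)).
have dp s : is_derive s (1 : R) psi (dpsi s).
  have -> : psi = (fun s => F (z0 + s *: v)) - dotv (grad F z0) v \*: id
      - (2^-1 * dotv v (H *m v)) \*: (id ^+ 2).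
    by apply/funext => x; rewrite /psi !fctE /= /GRing.scale /=; ring.
  by apply: is_derive_eq; rewrite /dpsi /GRing.scale /= expr1; field.
have [|c c01] := @MVT R psi dpsi 0 1 ltr01 (fun s _ => dp s).
  apply: derivable_within_continuous => s _.
  exact: (@ex_derive _ _ _ _ _ _ _ (dp s)).
rewrite subr0 mulr1 => E.
have -> : F z - F z0 - dotv (grad F z0) v - 2^-1 * dotv v (H *m v) = dpsi c.
  have zv : z0 + v = z by rewrite addrC subrK.
  by rewrite -E /psi scale1r scale0r addr0 zv; ring.
rewrite in_itv /= in c01; have /andP[c0 c1] := c01.
have -> : dpsi c = dotv (grad F (z0 + c *: v) - grad F z0
                          - H *m (c *: v)) v.
  by rewrite -scalemxAr !dotvDl !dotvNl dotvZl /dpsi (dotvC (H *m v)).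
have cv : z0 + c *: v - z0 = c *: v by rewrite (addrC z0) addrK.
have /rF : `|z0 + c *: v - z0| < r.
  rewrite cv normrZ gtr0_norm//.
  by rewrite (le_lt_trans _ zr)// ler_piMl// ltW.
rewrite cv => B.
rewrite (le_trans (ler_norm_dotv _ _))// expr2 mulrA ler_wpM2r//.
move: B => /(ler_wpM2l (ler0n R d)) /le_trans; apply.
rewrite mulrA; apply: ler_pM.
- by rewrite mulr_ge0// ltW.
- by [].
- exact/mulr_divS_le/ltW.
- by rewrite normrZ gtr0_norm// ler_piMl// ltW.
Qed.

(** Both orders of differentiation compute the limit of the same second
    difference quotient. *)
Lemma hess_sym (R : realType) d (F : 'cV[R]_d -> R) z :
  C2 F -> (hess F z)^T = hess F z.
Proof.
move=> cF; have [dF _ _] := cF.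
pose D (i l : 'I_d) (s : R) : R :=
  F (z + s *: delta_mx l 0 + s *: delta_mx i 0) - F (z + s *: delta_mx l 0)
  - (F (z + s *: delta_mx i 0) - F z).
have second_diff i l (e : R) : 0 < e -> exists2 r, 0 < r & forall s, 0 < s < r ->
    `|D i l s - s ^+ 2 * hess F z i l| <= e * s ^+ 2.
  move=> e0.
  have [r r0 rF] := strictly_differentiable z (C2_C1_partial i cF) e0.
  (* The points compared below are displaced along two coordinates. *)
  exists (r / 2); first by rewrite divr_gt0.
  move=> s /andP[s0 sr].
  pose ei : 'cV[R]_d := delta_mx i 0; pose el : 'cV[R]_d := delta_mx l 0.
  have ni k : `|delta_mx k 0 : 'cV[R]_d| <= 1.
    by apply: ler_mx_norm => // a b; rewrite mxE; case: (_ && _);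
       rewrite /= ?normr1 ?normr0.
  pose phi u := F (z + s *: el + u *: ei) - F (z + u *: ei).
  pose dphi u := partial F i (z + s *: el + u *: ei)
                 - partial F i (z + u *: ei).
  have dphiP u : is_derive u (1 : R) phi (dphi u).
    have pE y : partial F i y = dotv (grad F y) ei.
      by rewrite dotv_delta mxE.
    by rewrite /dphi !pE; apply: is_deriveB; exact: is_derive_line.
  have [|c c01] := @MVT R phi dphi 0 s s0 (fun s _ => dphiP s).
    apply: derivable_within_continuous => u _.
    exact: (@ex_derive _ _ _ _ _ _ _ (dphiP u)).
  rewrite in_itv /= in c01; have /andP[c0 cs] := c01.
  have -> : phi s - phi 0 = D i l s.
    by rewrite /phi /D !scale0r !addr0 -/ei -/el; ring.
  rewrite subr0 => ->.
  have cr : `|z + c *: ei - z| < r / 2.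
    rewrite addrC addKr normrZ gtr0_norm// (le_lt_trans _ sr)//.
    by rewrite (le_trans _ (ltW cs))// ler_piMr ?ni ?(ltW c0).
  have scr : `|z + s *: el + c *: ei - z| < r.
    have -> : z + s *: el + c *: ei - z = s *: el + (z + c *: ei - z).
      by rewrite -!addrA addrCA.
    rewrite (le_lt_trans (ler_normD _ _))// [ltRHS](splitr r) ltr_leD// ?(ltW cr)//.
    by rewrite normrZ gtr0_norm// (le_lt_trans _ sr)// ler_piMr ?ni ?(ltW s0).
  have cr' : `|z + c *: ei - z| < r.
    by rewrite (lt_trans cr)// gtr_pMr// invf_lt1// ltr1n.
  have := rF _ _ scr cr'.
  have -> : z + s *: el + c *: ei - (z + c *: ei) = s *: el.
    by rewrite [z + _ + _]addrAC [LHS]addrC addKr.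
  rewrite dotvZr dotv_delta normrZ gtr0_norm// !mxE -/(dphi c) => B.
  have -> : dphi c * s - s ^+ 2 * partial (partial F i) l z =
      s * (dphi c - s * partial (partial F i) l z) by ring.
  rewrite normrM gtr0_norm//.
  have : s * `|dphi c - s * partial (partial F i) l z| <= s * (e * (s * `|el|)).
    by rewrite ler_wpM2l// ltW.
  move=> /le_trans; apply; rewrite mulrCA ler_wpM2l ?(ltW e0)//.
  rewrite expr2 ler_wpM2l ?(ltW s0)//.
  by rewrite ler_piMr ?ni ?(ltW s0).
apply/matrixP => l i; rewrite [LHS]mxE; apply/eqP; rewrite -subr_eq0 -normr_le0.
apply/ler_addgt0Pr => e e0; rewrite add0r.
have e20 : 0 < e / 2 by rewrite divr_gt0.
have [r1 r10 B1] := second_diff i l _ e20.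
have [r2 r20 B2] := second_diff l i _ e20.
pose s := Num.min r1 r2 / 2.
have m0 : 0 < Num.min r1 r2 by rewrite lt_min r10.
have s0 : 0 < s by rewrite divr_gt0.
have sm : s < Num.min r1 r2 by rewrite gtr_pMr// invf_lt1// ltr1n.
move: (sm); rewrite lt_min => /andP[s1 s2].
have s20 : 0 < s ^+ 2 by rewrite exprn_gt0.
have := B1 s; rewrite s0 s1 => /(_ isT) {}B1.
have := B2 s; rewrite s0 s2 => /(_ isT) {}B2.
have Dsym : D i l s = D l i s.
  by rewrite /D [z + _ + _]addrAC; ring.
rewrite -(ler_pM2l s20) -{1}(gtr0_norm s20) -normrM.
move: B1 B2; rewrite Dsym !ler_norml => /andP[a1 a2] /andP[b1 b2].
by apply/andP; split; lra.
Qed.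

(** * Compactness arguments *)

Lemma lipschitz_on_continuous (R : realType) (V W : normedModType R)
    (f : V -> W) (A : set V) (k : R) :
  (forall x y, A x -> A y -> `|f x - f y| <= k * `|x - y|) ->
  {within A, continuous f}.
Proof.
move=> lip; apply/subspace_continuousP => x Ax; apply/cvgrPdist_le => e e0.
have k0 : 0 < `|k| + 1 by rewrite ltr_wpDl.
rewrite near_withinE; apply/nbhs_ballP.
exists (e / (`|k| + 1)); first exact: divr_gt0.
move=> y; rewrite -ball_normE /= ltr_pdivlMr// => xy Ay.
rewrite (le_trans (lip _ _ Ax Ay))// (le_trans _ (ltW xy))// mulrC ler_wpM2l//.
by rewrite (le_trans (ler_norm k))// lerDl.
Qed.

Lemma lipschitz_map_continuous (R : realType) (V W : normedModType R)
    (f : V -> W) (k : R) :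
  (forall x y, `|f x - f y| <= k * `|x - y|) -> continuous f.
Proof.
move=> lip; apply/continuous_subspace_setT.
exact: (lipschitz_on_continuous (k := k)).
Qed.

Lemma trmx_isometry (R : realType) m n (A : 'M[R]_(m, n)) : `|A^T| = `|A|.
Proof.
apply/eqP; rewrite eq_le; apply/andP; split; apply: ler_mx_norm => // i j.
  by rewrite mxE ler_norm_entry.
by rewrite -{1}[A]trmxK mxE ler_norm_entry.
Qed.

Lemma cV_bounded_closed_compact (R : realType) n (A : set 'cV[R]_n) :
  bounded_set A -> closed A -> compact A.
Proof.
move=> bA cA.
have ct m p : continuous (fun x : 'M[R]_(m, p) => x^T).
  apply: (@lipschitz_map_continuous R _ _ _ 1) => x y.
  by rewrite -linearB/= trmx_isometry mul1r.
have -> : A = trmx @` ((@trmx R 1 n) @^-1` A).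
  by apply/seteqP; split=> [x Ax|_ [y Ay <-]//]; exists x^T; rewrite /= ?trmxK.
apply: continuous_compact; first exact/continuous_subspaceT/ct.
apply: bounded_closed_compact.
  case: bA => M [Mr MA]; exists M; split=> // x /MA {}MA y Ay.
  by rewrite /= -trmx_isometry; exact: MA.
by apply: closed_comp => // x _; exact: ct.
Qed.

Lemma cV_closed_ball_compact (R : realType) n (r : R) :
  compact [set y : 'cV[R]_n | `|y| <= r].
Proof.
apply: cV_bounded_closed_compact.
  by exists r; split=> [|x rx y /= yr]; rewrite ?num_real// (le_trans yr)// ltW.
apply: (@closed_comp _ _ (fun y : 'cV[R]_n => `|y|) [set x | x <= r]).
  by move=> x _; exact: norm_continuous.
exact: closed_le.
Qed.

(** The displacement [`|y - Phi y|] attains its minimum on a ball that [Phi]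
    maps into itself; there [Phi] would halve it, so it vanishes. *)
Lemma half_contraction_fixpoint (R : realType) n (Phi : 'cV[R]_n -> 'cV[R]_n)
    (r : R) :
  (forall y y', `|y| <= r -> `|y'| <= r ->
     `|Phi y - Phi y'| <= 2^-1 * `|y - y'|) ->
  `|Phi 0| <= r / 2 ->
  exists2 y, `|y| <= 2 * `|Phi 0| & Phi y = y.
Proof.
move=> lip Phi0; set rho := 2 * `|Phi 0|.
have rho0 : 0 <= rho by rewrite mulr_ge0.
have rhor : rho <= r by rewrite /rho; lra.
have stab y : `|y| <= rho -> `|Phi y| <= rho.
  move=> yr; have := lip y 0; rewrite normr0 subr0.
  move=> /(_ (le_trans yr rhor) (le_trans rho0 rhor)) B.
  have := ler_distD (Phi 0) (Phi y) 0; rewrite !subr0 => C.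
  by rewrite /rho in yr *; lra.
have [||c] := @compact_EVT_min 'cV[R]_n R (fun y : 'cV[R]_n => `|y - Phi y|)
    _ _ (@cV_closed_ball_compact R n rho).
- by exists 0; rewrite /= normr0.
- apply: (lipschitz_on_continuous (k := 2)) => x y xr yr.
  have := lip x y (le_trans xr rhor) (le_trans yr rhor).
  have := ler_dist_dist (x - Phi x) (y - Phi y).
  have -> : x - Phi x - (y - Phi y) = (x - y) - (Phi x - Phi y).
    by rewrite !opprD !opprK addrACA.
  by have := ler_normB (x - y) (Phi x - Phi y); have := normr_ge0 (x - y); lra.
rewrite inE /= => cr cmin; exists c => //.
have := cmin (Phi c); rewrite inE /= => /(_ (stab _ cr)) le1.
have le2 := lip c (Phi c) (le_trans cr rhor) (le_trans (stab _ cr) rhor).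
apply/esym/eqP; rewrite -subr_eq0 -normr_le0; lra.
Qed.

Lemma mulmx_continuous (R : realType) m n (A : 'M[R]_(m, n)) :
  continuous (fun x : 'cV[R]_n => A *m x).
Proof.
apply: (@lipschitz_map_continuous R _ _ _ (n%:R * `|A|)) => x y.
by rewrite -mulmxBr ler_norm_mulmx.
Qed.

Lemma norm_mulmx_continuous (R : realType) m n (A : 'M[R]_(m, n)) :
  continuous (fun x : 'cV[R]_n => `|A *m x|).
Proof.
apply: (@lipschitz_map_continuous R _ _ _ (n%:R * `|A|)) => x y.
by rewrite (le_trans (ler_dist_dist _ _))// -mulmxBr ler_norm_mulmx.
Qed.

Lemma dotv_mulmx_continuous (R : realType) d (H : 'M[R]_d) :
  continuous (fun x : 'cV[R]_d => dotv x (H *m x)).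
Proof.
have -> : (fun x : 'cV[R]_d => dotv x (H *m x)) =
    (fun x => \sum_i x i 0 * (H *m x) i 0).
  by apply/funext => x; rewrite dotvE.
apply: continuous_big => [|i _]; first exact: add_continuous.
move=> x; apply: continuousM; first exact: coord_continuous.
apply: (@continuous_comp _ _ _ (fun x => H *m x) (fun y : 'cV[R]_d => y i 0)).
  exact: mulmx_continuous.
exact: coord_continuous.
Qed.

(** Finsler's lemma: by compactness of the unit sphere, a form that is
    positive on a kernel becomes positive definite once enough of the squared
    constraint violation is added. *)
Lemma definite_on_kernel (R : realType) d n (H : 'M[R]_d) (J : 'M[R]_(n, d)) :
  (forall x, J *m x = 0 -> x != 0 -> 0 < dotv x (H *m x)) ->
  exists2 k, 0 < k & forall x,
    k^-1 * `|x| ^+ 2 <= dotv x (H *m x) + k * `|J *m x| ^+ 2.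
Proof.
move=> posH; pose S := [set x : 'cV[R]_d | `|x| = 1].
have cS : compact S.
  apply: cV_bounded_closed_compact.
    by exists 1; split=> [|x rx y /= ->]; rewrite ?num_real// ltW.
  apply: (@closed_comp _ _ (fun y : 'cV[R]_d => `|y|) [set x | x = 1]).
    by move=> x _; exact: norm_continuous.
  exact: closed_eq.
have nS : \forall k \near +oo, S `<=`
    [set x | k^-1 <= dotv x (H *m x) + k * `|J *m x| ^+ 2].
  apply: ((compact_near_coveringP S).1 cS R (pinfty_nbhs R)
    (fun k x => k^-1 <= dotv x (H *m x) + k * `|J *m x| ^+ 2)).
  move=> x Sx.
  have cH := @dotv_mulmx_continuous R d H x.
  have [Jx0|Jx0] := eqVneq (J *m x) 0.
    have hx : 0 < dotv x (H *m x).
      apply: posH => //; apply/eqP => x0.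
      by move: Sx; rewrite /S /= x0 normr0 => /esym/eqP; rewrite oner_eq0.
    near=> x' k => /=.
    have k0 : 0 < k by near: k; exact: nbhs_pinfty_gt.
    have hx' : dotv x (H *m x) / 2 < dotv x' (H *m x').
      near: x'; apply: (cvgr_gt _ cH) => //.
      by rewrite gtr_pMr// invf_lt1// ltr1n.
    have kh : k^-1 <= dotv x (H *m x) / 2.
      have kl : (dotv x (H *m x) / 2)^-1 <= k.
        by near: k; apply: nbhs_pinfty_ge; rewrite num_real.
      by rewrite -[leRHS]invrK lef_pV2 ?posrE ?invr_gt0 ?divr_gt0.
    by rewrite (le_trans kh)// (le_trans (ltW hx'))// lerDl mulr_ge0// ltW.
  have cJ := @norm_mulmx_continuous R n d J x.
  have Jgt0 : 0 < `|J *m x| by rewrite normr_gt0.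
  near=> x' k => /=.
  have k1 : 1 < k by near: k; exact: nbhs_pinfty_gt.
  have k0 : 0 < k by lra.
  have hx' : dotv x (H *m x) - 1 < dotv x' (H *m x').
    by near: x'; apply: (cvgr_gt _ cH) => //; lra.
  have Jx' : `|J *m x| / 2 < `|J *m x'|.
    by near: x'; apply: (cvgr_gt _ cJ) => //; rewrite gtr_pMr// invf_lt1// ltr1n.
  have kh : (2 - dotv x (H *m x)) / (`|J *m x| / 2) ^+ 2 <= k.
    by near: k; apply: nbhs_pinfty_ge; rewrite num_real.
  rewrite ler_pdivrMr ?exprn_gt0 ?divr_gt0// in kh.
  have kk : k^-1 <= 1 by rewrite invf_le1// ltW.
  have : k * (`|J *m x| / 2) ^+ 2 <= k * `|J *m x'| ^+ 2.
    rewrite ler_wpM2l ?(ltW k0)//; apply: lerXn2r; rewrite ?nnegrE//.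
    exact: ltW.
  by lra.
have [k [k0 kS]] : exists k, 0 < k /\ S `<=`
    [set x | k^-1 <= dotv x (H *m x) + k * `|J *m x| ^+ 2].
  have k_gt0 : \forall k \near (pinfty_nbhs R), 0 < k.
    by apply: nbhs_pinfty_gt; rewrite num_real.
  near (pinfty_nbhs R) => k; exists k; split; near: k => //.
exists k => // x; have [->|x0] := eqVneq x 0.
  by rewrite dotv0l !mulmx0 !normr0 expr0n /= !mulr0 addr0.
have nx : 0 < `|x| by rewrite normr_gt0.
have [a [u [a0 -> Su]]] : exists a u, [/\ 0 < a, x = a *: u & S u].
  exists `|x|, (`|x|^-1 *: x); split=> //.
    by rewrite scalerA divff ?scale1r// gt_eqF.
  by rewrite /S /= normrZ normfV normr_id mulVf// gt_eqF.
have := kS u Su; move: Su; rewrite /S /= => Su B.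
rewrite -!scalemxAr dotvZl dotvZr !normrZ gtr0_norm// Su mulr1.
have -> : a * (a * dotv u (H *m u)) + k * (a * `|J *m u|) ^+ 2 =
  (dotv u (H *m u) + k * `|J *m u| ^+ 2) * a ^+ 2 by ring.
by rewrite ler_wpM2r// sqr_ge0.
Unshelve. all: by end_near.
Qed.

(** * Linear combinations of [C2] functions *)

Lemma differentiable_lin (R : realType) d (F G : 'cV[R]_d -> R) (a : R) z :
  differentiable F z -> differentiable G z ->
  differentiable (fun z => F z + a * G z) z.
Proof. by move=> dF dG; apply: differentiableD => //; apply: differentiableZ. Qed.

Lemma partial_lin (R : realType) d (F G : 'cV[R]_d -> R) (a : R) i z :
  differentiable F z -> differentiable G z ->
  partial (fun z => F z + a * G z) i z = partial F i z + a * partial G i z.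
Proof.
move=> dF dG.
have dFv := derivableP (diff_derivable (v := delta_mx i 0) dF).
have dGv := derivableP (diff_derivable (v := delta_mx i 0) dG).
exact: (@derive_val _ _ _ _ _ _ _ (is_deriveD dFv (is_deriveZ a dGv))).
Qed.

Lemma grad_lin (R : realType) d (F G : 'cV[R]_d -> R) (a : R) z :
  differentiable F z -> differentiable G z ->
  grad (fun z => F z + a * G z) z = grad F z + a *: grad G z.
Proof. by move=> dF dG; apply/colP => i; rewrite !mxE partial_lin. Qed.

Lemma continuous_lin (R : realType) (T : topologicalType) (F G : T -> R)
    (a : R) :
  continuous F -> continuous G -> continuous (fun z => F z + a * G z).
Proof.
move=> cF cG z; apply: (@continuousD R R T F (fun z => a * G z)).
  exact: cF.
by apply: continuousM; [exact: cvg_cst|exact: cG].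
Qed.

Lemma C2_lin (R : realType) d (F G : 'cV[R]_d -> R) (a : R) :
  C2 F -> C2 G -> C2 (fun z => F z + a * G z).
Proof.
move=> [dF pF cF] [dG pG cG].
have E i : partial (fun z => F z + a * G z) i =
    (fun z => partial F i z + a * partial G i z).
  by apply/funext => z; exact: partial_lin.
split=> [z|i z|i l]; first exact: differentiable_lin.
  by rewrite E; exact: differentiable_lin.
rewrite E; have -> : partial (fun z => partial F i z + a * partial G i z) l =
    (fun z => partial (partial F i) l z + a * partial (partial G i) l z).
  by apply/funext => z; exact: partial_lin.
exact: continuous_lin.
Qed.

Lemma C2_lin_sum (R : realType) d (I : Type) (r : seq I)
    (F : 'cV[R]_d -> R) (a : I -> R) (G : I -> 'cV[R]_d -> R) :
  C2 F -> (forall i, C2 (G i)) -> C2 (fun z => F z + \sum_(i <- r) a i * G i z).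
Proof.
move=> cF cG; elim: r => [|i r IHr].
  by under eq_fun do rewrite big_nil addr0.
have -> : (fun z => F z + \sum_(j <- i :: r) a j * G j z) =
    (fun z => (F z + \sum_(j <- r) a j * G j z) + a i * G i z).
  by apply/funext => z; rewrite big_cons addrCA addrC.
exact: (C2_lin (a i) IHr (cG i)).
Qed.

Lemma grad_lin_sum (R : realType) d (I : Type) (r : seq I)
    (F : 'cV[R]_d -> R) (a : I -> R) (G : I -> 'cV[R]_d -> R) z :
  C2 F -> (forall i, C2 (G i)) ->
  grad (fun z => F z + \sum_(i <- r) a i * G i z) z =
  grad F z + \sum_(i <- r) a i *: grad (G i) z.
Proof.
move=> cF cG; elim: r => [|i r IHr].
  by under eq_fun do rewrite big_nil addr0; rewrite big_nil addr0.
have -> : (fun z => F z + \sum_(j <- i :: r) a j * G j z) =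
    (fun z => (F z + \sum_(j <- r) a j * G j z) + a i * G i z).
  by apply/funext => x; rewrite big_cons addrCA addrC.
have [dL _ _] := C2_lin_sum r a cF cG; have [dG _ _] := cG i.
by rewrite grad_lin// IHr big_cons -addrA [X in _ + X]addrC.
Qed.

Lemma C2B (R : realType) d (F G : 'cV[R]_d -> R) :
  C2 F -> C2 G -> C2 (fun z => F z - G z).
Proof.
move=> cF cG; have -> : (fun z => F z - G z) = (fun z => F z + (-1) * G z).
  by apply/funext => z; rewrite mulN1r.
exact: (C2_lin (-1) cF cG).
Qed.

Lemma gradB (R : realType) d (F G : 'cV[R]_d -> R) z :
  C2 F -> C2 G -> grad (fun z => F z - G z) z = grad F z - grad G z.
Proof.
move=> [dF _ _] [dG _ _].
have -> : (fun z => F z - G z) = (fun z => F z + (-1) * G z).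
  by apply/funext => x; rewrite mulN1r.
by rewrite grad_lin// scaleN1r.
Qed.

(** * The perturbed program *)

(** Local estimates are stated for all sufficiently small radii [r], as a
    filter on [r] bounding both [t] and the distance to [z0], so that filter
    lemmas combine them. *)
Lemma small_radius1 (R : realType) (V : normedModType R) (z0 : V)
    (Q : V -> Prop) :
  (exists2 r : R, 0 < r & forall x, `|x - z0| < r -> Q x) ->
  \forall r \near 0^'+, forall x, `|x - z0| < r -> Q x.
Proof.
move=> [r r0 rQ]; near=> s => x xs; apply: rQ; apply: (lt_trans xs).
by near: s; exact: nbhs_right_lt.
Unshelve. all: by end_near. Qed.

Lemma small_radius2 (R : realType) (V : normedModType R) (z0 : V)
    (Q : V -> V -> Prop) :
  (exists2 r : R, 0 < r &
     forall x y, `|x - z0| < r -> `|y - z0| < r -> Q x y) ->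
  \forall r \near 0^'+,
     forall x y, `|x - z0| < r -> `|y - z0| < r -> Q x y.
Proof.
move=> [r r0 rQ]; near=> s => x y xs ys.
have sr : s < r by near: s; exact: nbhs_right_lt.
by apply: rQ; [exact: lt_trans sr|exact: lt_trans sr].
Unshelve. all: by end_near. Qed.

Lemma interp_near (R : realType) d (F G : 'cV[R]_d -> R) a (e : R) :
  continuous F -> continuous G -> 0 < e -> \forall r \near 0^'+,
  forall t z, 0 < t < r -> `|z - a| < r -> `|interp F G t z - F a| <= e.
Proof.
move=> cF cG e0; have e20 : 0 < e / 2 by rewrite divr_gt0.
have n1 : \forall r \near 0^'+, forall z, `|z - a| < r -> `|F z - F a| <= e / 2.
  apply/small_radius1/near_ball_ex.
  have /cvgrPdist_le := cF a => /(_ _ e20).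
  by apply: filterS => z; rewrite distrC.
pose M := `|G a - F a| + 1.
have M0 : 0 < M by rewrite ltr_wpDl.
have n2 : \forall r \near 0^'+, forall z, `|z - a| < r -> `|G z - F z| <= M.
  apply/small_radius1/near_ball_ex.
  have cD : continuous (fun z => G z + (-1) * F z) by exact: continuous_lin.
  have /cvgrPdist_le := cD a => /(_ _ ltr01).
  apply: filterS => z; rewrite !mulN1r distrC => B.
  have := ler_normD (G z - F z - (G a - F a)) (G a - F a).
  by rewrite subrK /M; lra.
have n3 : \forall r \near 0^'+, r < e / 2 / M.
  by apply: nbhs_right_lt; rewrite divr_gt0.
apply: filterS3 n1 n2 n3 => r S1 S2 rM t z /andP[t0 tr] zr.
have -> : interp F G t z - F a = (F z - F a) + t * (G z - F z).
  by rewrite /interp; ring.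
rewrite (le_trans (ler_normD _ _))// [e in leRHS]splitr lerD ?S1//.
rewrite normrM gtr0_norm// (le_trans (ler_wpM2l (ltW t0) (S2 z zr)))//.
by rewrite -ler_pdivlMr// ltW// (lt_trans tr).
Qed.

Section PerturbedProgram.
Variables (R : realType) (d n : nat).
Variables (f0 f1 : 'cV[R]_d -> R) (c0 c1 : 'I_n -> 'cV[R]_d -> R).
Variables (E : pred 'I_n) (z0 : 'cV[R]_d) (lam : 'cV[R]_n).

(** Equality constraints ([E i]) and inequality constraints share one index
    set. *)
Definition feas (t : R) : set 'cV[R]_d :=
  [set z | forall i, (E i -> interp (c0 i) (c1 i) t z = 0) /\
                     (~~ E i -> interp (c0 i) (c1 i) t z <= 0)].

Definition active i := E i || (c0 i z0 == 0).

Definition lag z := f0 z + \sum_i lam i 0 * c0 i z.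

Definition dlag z := f1 z - f0 z + \sum_i lam i 0 * (c1 i z - c0 i z).

(** The rows and entries of inactive constraints are set to zero, so that the
    active system keeps the index set of all constraints. *)
Definition jac : 'M[R]_(n, d) :=
  \matrix_(i, l) if active i then grad (c0 i) z0 l 0 else 0.

Definition cval t z : 'cV[R]_n :=
  \col_i if active i then interp (c0 i) (c1 i) t z else 0.

Definition cshift : 'cV[R]_n :=
  \col_i if active i then c1 i z0 - c0 i z0 else 0.

Hypotheses (C2f0 : C2 f0) (C2f1 : C2 f1).
Hypotheses (C2c0 : forall i, C2 (c0 i)) (C2c1 : forall i, C2 (c1 i)).
Hypothesis feas0 : feas 0 z0.

Lemma C2_lag : C2 lag.
Proof. exact: (C2_lin_sum _ (fun i => lam i 0) C2f0 C2c0). Qed.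

Lemma C2_dlag : C2 dlag.
Proof.
exact: (C2_lin_sum _ (fun i => lam i 0) (C2B C2f1 C2f0)
  (fun i => C2B (C2c1 i) (C2c0 i))).
Qed.

Lemma interp0 (F G : 'cV[R]_d -> R) z : interp F G 0 z = F z.
Proof. by rewrite /interp mul0r addr0. Qed.

Lemma active_c0 i : active i -> c0 i z0 = 0.
Proof.
have [Ei _] := feas0 i; rewrite interp0 in Ei.
by case/orP => [/Ei//|/eqP].
Qed.

Lemma jacE x i : (jac *m x) i 0 = if active i then dotv (grad (c0 i) z0) x else 0.
Proof.
rewrite mxE dotvE; case: ifP => ai.
  by apply: eq_bigr => l _; rewrite mxE ai.
by rewrite big1// => l _; rewrite mxE ai mul0r.
Qed.

(** The bound is uniform in [t]: the part of the constraint that is multiplied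
    by [t] is Lipschitz near [z0], with a constant that a small [t] makes
    negligible. *)
Lemma cval_strict (e : R) : 0 < e -> \forall r \near 0^'+,
  forall t x y, 0 < t < r -> `|x - z0| < r -> `|y - z0| < r ->
    `|cval t x - cval t y - jac *m (x - y)| <= e * `|x - y|.
Proof.
move=> e0; have e20 : 0 < e / 2 by rewrite divr_gt0.
pose Q i r := forall t x y, 0 < t < r -> `|x - z0| < r -> `|y - z0| < r ->
    `|interp (c0 i) (c1 i) t x - interp (c0 i) (c1 i) t y
      - dotv (grad (c0 i) z0) (x - y)| <= e * `|x - y|.
have nQ : \forall r \near 0^'+, forall i, Q i r.
  apply: (@filter_forall _ _ Q) => i.
  pose D z := c1 i z - c0 i z.
  have C2D : C2 D := C2B (C2c1 i) (C2c0 i).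
  have n1 := small_radius2 (strictly_differentiable z0 (C2_C1 (C2c0 i)) e20).
  have n2 := small_radius2 (strictly_differentiable z0 (C2_C1 C2D) ltr01).
  pose K := d%:R * `|grad D z0| + 1.
  have K0 : 0 < K by rewrite ltr_wpDl// mulr_ge0.
  have n3 : \forall r \near 0^'+, r < e / 2 / K.
    by apply: nbhs_right_lt; rewrite divr_gt0.
  apply: filterS3 n1 n2 n3 => r S1 S2 rK.
  move=> t x y /andP[t0 tr] xr yr.
  have B1 := S1 x y xr yr; have B2 := S2 x y xr yr.
  have B3 : `|D x - D y| <= K * `|x - y|.
    have := ler_norm_dotv (grad D z0) (x - y).
    have := ler_normD (D x - D y - dotv (grad D z0) (x - y))
                      (dotv (grad D z0) (x - y)).
    by rewrite subrK /K mulrDl; lra.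
  have tK : t * K <= e / 2 by rewrite -ler_pdivlMr// ltW// (lt_trans tr).
  have -> : interp (c0 i) (c1 i) t x - interp (c0 i) (c1 i) t y
      - dotv (grad (c0 i) z0) (x - y) =
      (c0 i x - c0 i y - dotv (grad (c0 i) z0) (x - y)) + t * (D x - D y).
    by rewrite /interp /D; ring.
  rewrite (le_trans (ler_normD _ _))// [e in leRHS]splitr mulrDl lerD//.
  rewrite normrM gtr0_norm// (le_trans (ler_wpM2l (ltW t0) B3))// mulrA.
  by rewrite ler_wpM2r.
apply: filterS nQ => r Qr.
move=> t x y tr xr yr.
apply: ler_mx_norm => [|i j]; first by rewrite mulr_ge0// ltW.
rewrite ord1 mxE (mxE _ _ i) [X in _ + X]mxE jacE !mxE.
case: ifP => ai; last by rewrite !subr0 normr0 mulr_ge0// ltW.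
exact: Qr.
Qed.

Lemma cval_at_z0 t : cval t z0 = t *: cshift.
Proof.
apply/colP => i; rewrite !mxE; case: ifP => ai; last by rewrite mulr0.
by rewrite /interp active_c0// add0r subr0.
Qed.

Section Expansions.
Variable dz : 'cV[R]_d.
Hypothesis jac_dz : jac *m dz = - cshift.

(** The choice [J dz = - cshift] cancels the first-order effect of [t], so that
    only the deviation from the tangent line remains. *)
Lemma cval_expand (e : R) : 0 < e -> \forall r \near 0^'+,
  forall t z, 0 < t < r -> `|z - z0| < r ->
    `|cval t z - jac *m (z - z0 - t *: dz)|
      <= e * (t + `|z - z0 - t *: dz|).
Proof.
move=> e0; set D := `|dz|.
have D0 : 0 <= D by exact: normr_ge0.
have e'0 : 0 < e / (D + 1) by rewrite divr_gt0// ltr_wpDl.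
have n1 := cval_strict e'0.
apply: filterS2 n1 (nbhs_right_gt 0) => r S1 r0 t z /andP[t0 tr] zr.
have z0r : `|z0 - z0| < r by rewrite subrr normr0.
have := S1 t z z0 _ zr z0r; rewrite t0 tr => /(_ isT).
have -> : cval t z - cval t z0 - jac *m (z - z0) =
    cval t z - jac *m (z - z0 - t *: dz).
  by rewrite cval_at_z0 [in RHS]mulmxBr -scalemxAr jac_dz scalerN opprK;
     rewrite opprD addrA [in RHS]addrAC.
move=> /le_trans; apply; rewrite -mulrA ler_wpM2l ?(ltW e0)//.
rewrite ler_pdivrMl ?ltr_wpDl//.
have := ler_normD (z - z0 - t *: dz) (t *: dz).
rewrite subrK normrZ gtr0_norm// -/D.
by have := normr_ge0 (z - z0 - t *: dz); nra.
Qed.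

Lemma shift_norm (z : 'cV[R]_d) t : 0 < t ->
  `|z - z0| ^+ 2 <= 2 * (`|dz| ^+ 2 * t ^+ 2 + `|z - z0 - t *: dz| ^+ 2).
Proof.
move=> t0; have := ler_normD (z - z0 - t *: dz) (t *: dz).
rewrite subrK normrZ gtr0_norm//.
have := normr_ge0 (z - z0); have := normr_ge0 (z - z0 - t *: dz).
have := normr_ge0 dz.
move: `|dz| `|z - z0| `|z - z0 - t *: dz| => D a b D0 b0 a0 ab.
have : a ^+ 2 <= (b + t * D) ^+ 2 by apply: lerXn2r; rewrite ?nnegrE//; nra.
by have := sqr_ge0 (b - t * D); lra.
Qed.

Let H := hess lag z0.
Let q := grad dlag z0.

(** The second-order value of the relaxation [lag + t * dlag] at
    [z0 + t dz]. *)
Definition value2 t := f0 z0 + t * dlag z0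
  + t ^+ 2 * (2^-1 * dotv dz (H *m dz) + dotv dz q).

Hypothesis grad_lag0 : grad lag z0 = 0.
Hypothesis lam_inactive : forall i, ~~ active i -> lam i 0 = 0.

Lemma lag_z0 : lag z0 = f0 z0.
Proof.
rewrite /lag big1 ?addr0// => i _.
have [/active_c0 ->|/lam_inactive ->] := boolP (active i).
  by rewrite mulr0.
by rewrite mul0r.
Qed.

(** Taylor expansion of order two for [lag], which is stationary at [z0], and of
    order one for [dlag], which carries a factor [t]. *)
Lemma lag_expand (e : R) : 0 < e -> \forall r \near 0^'+,
  forall t z, 0 < t < r -> `|z - z0| < r ->
    let w := z - z0 - t *: dz in
    `|lag z + t * dlag z
      - (value2 t + t * dotv w (H *m dz + q) + 2^-1 * dotv w (H *m w))|
      <= e * (t ^+ 2 + `|w| ^+ 2).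
Proof.
move=> e0; pose D := `|dz|.
have D0 : 0 <= D by exact: normr_ge0.
(* [|z - z0| ^ 2 <= 2 (D ^ 2 t ^ 2 + |w| ^ 2)] and
   [t |z - z0| <= (D + 1) t ^ 2 + |w| ^ 2], which add up to at most
   [K (t ^ 2 + |w| ^ 2)]. *)
pose K := 2 * D ^+ 2 + D + 4.
have K0 : 0 < K by rewrite /K; have := sqr_ge0 D; lra.
have e'0 : 0 < e / K by rewrite divr_gt0.
have n1 := small_radius1 (taylor2 z0 C2_lag e'0).
have n2 := small_radius2 (strictly_differentiable z0 (C2_C1 C2_dlag) e'0).
apply: filterS3 n1 n2 (nbhs_right_gt 0) => r S1 S2 r0 t z /andP[t0 tr] zr /=.
set w := z - z0 - t *: dz.
have z0r : `|z0 - z0| < r by rewrite subrr normr0.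
have := S1 z zr; have := S2 z z0 zr z0r; have := shift_norm z t0.
have zw : z - z0 = t *: dz + w by rewrite [RHS]addrC subrK.
have nzw : `|z - z0| <= t * D + `|w|.
  by rewrite zw (le_trans (ler_normD _ _))// normrZ gtr0_norm.
rewrite grad_lag0 dotv0l subr0 lag_z0 -/H -/q -/w.
clearbody w.
set N := `|z - z0| in nzw *; set W := `|w| in nzw *.
have N0 : 0 <= N by exact: normr_ge0.
have W0 : 0 <= W by exact: normr_ge0.
rewrite zw (dotvC q) mulmxDr !dotvDl !dotvDr -!scalemxAr !dotvZl !dotvZr.
rewrite (dotv_mulmx_sym dz w (hess_sym z0 C2_lag)) -/H /value2.
move=> B1 B2 B3.
have -> : lag z + t * dlag z - (f0 z0 + t * dlag z0 +
   t ^+ 2 * (2^-1 * dotv dz (H *m dz) + dotv dz q) +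
   t * (dotv w (H *m dz) + dotv w q) + 2^-1 * dotv w (H *m w)) =
   (lag z - f0 z0 - 2^-1 * (t * (t * dotv dz (H *m dz)) +
     t * dotv w (H *m dz) + (t * dotv w (H *m dz) + dotv w (H *m w))))
   + t * (dlag z - dlag z0 - (t * dotv dz q + dotv w q)) by field.
rewrite (le_trans (ler_normD _ _))// normrM (gtr0_norm t0).
have B2' := ler_wpM2l (ltW t0) B2.
have -> : e = e / K * K by rewrite divfK// gt_eqF.
have : e / K * N ^+ 2 <= e / K * (2 * (D ^+ 2 * t ^+ 2 + W ^+ 2)).
  by rewrite ler_wpM2l// ltW.
have : t * (e / K * N) <= e / K * ((D + 1) * t ^+ 2 + W ^+ 2).
  rewrite mulrCA ler_wpM2l ?(ltW e'0)//.
  have : t * N <= t * (t * D + W) by rewrite ler_wpM2l// ltW.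
  by have := sqr_ge0 (t - W); have := sqr_ge0 t; have := sqr_ge0 W; nra.
have : e / K * ((2 * (D ^+ 2 * t ^+ 2 + W ^+ 2)) + ((D + 1) * t ^+ 2 + W ^+ 2))
    <= e / K * (K * (t ^+ 2 + W ^+ 2)).
  rewrite ler_wpM2l ?(ltW e'0)// /K.
  have := sqr_ge0 t; have := mulr_ge0 (sqr_ge0 D) (sqr_ge0 W).
  by have := mulr_ge0 D0 (sqr_ge0 W); have := sqr_ge0 W; nra.
move=> C1 C2 C3; apply: (le_trans (lerD B3 B2')).
rewrite -[e / K * K * _]mulrA.
apply: le_trans C1; rewrite mulrDr; exact: lerD.
Qed.

Lemma relaxation_gap t z : interp f0 f1 t z =
  lag z + t * dlag z + \sum_i - (lam i 0 * interp (c0 i) (c1 i) t z).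
Proof.
have -> : \sum_i - (lam i 0 * interp (c0 i) (c1 i) t z) =
    - (\sum_i lam i 0 * c0 i z) - t * \sum_i lam i 0 * (c1 i z - c0 i z).
  rewrite mulr_sumr -!sumrN -big_split /=; apply: eq_bigr => i _.
  by rewrite /interp; ring.
by rewrite /lag /dlag /interp; ring.
Qed.

Hypothesis lam_pos : forall i, ~~ E i -> active i -> 0 < lam i 0.

(** Strict complementarity: the terms dropped by the relaxation control the
    violation of every active constraint linearly. *)
Lemma slack_bound : exists2 s : R, 0 < s & forall t z, feas t z ->
  s * `|cval t z| <= \sum_i - (lam i 0 * interp (c0 i) (c1 i) t z).
Proof.
pose s := \big[Num.min/(1:R)]_(i | ~~ E i && active i) lam i 0.
have s0 : 0 < s.
  rewrite /s; elim/big_ind: _ => // [x y x0 y0|i /andP[]].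
    by rewrite lt_min x0.
  exact: lam_pos.
exists s => // t z fz.
have ge0 i : 0 <= - (lam i 0 * interp (c0 i) (c1 i) t z).
  have [fE fI] := fz i; have [/fE ->|nE] := boolP (E i).
    by rewrite mulr0 oppr0.
  rewrite -mulrN; have := fI nE; rewrite -oppr_ge0 => I0.
  have [ai|/lam_inactive ->] := boolP (active i); last by rewrite mul0r.
  by rewrite mulr_ge0// ltW// lam_pos.
have S0 : 0 <= \sum_i - (lam i 0 * interp (c0 i) (c1 i) t z).
  exact: sumr_ge0.
rewrite mulrC -ler_pdivlMr//; apply: ler_mx_norm => [|i j].
  by rewrite divr_ge0// ltW.
rewrite ler_pdivlMr// mxE; case: ifP => ai; last by rewrite normr0 mul0r.
have [fE fI] := fz i; have [/fE ->|nE] := boolP (E i).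
  by rewrite normr0 mul0r.
rewrite (ler0_norm (fI nE)) (bigD1 i) //=.
have : 0 <= \sum_(k | k != i) - (lam k 0 * interp (c0 k) (c1 k) t z).
  by apply: sumr_ge0.
have : s <= lam i 0 by apply: bigmin_le_cond; rewrite nE ai.
have := fI nE; nra.
Qed.

Hypothesis definite : forall x, jac *m x = 0 -> x != 0 ->
  0 < dotv x (H *m x).
Variable zeta : 'cV[R]_n.
Hypothesis stationary_dz : H *m dz + q = - (jac^T *m zeta).

Lemma cval_bound : exists2 K, 0 < K & \forall r \near 0^'+,
  forall t z, 0 < t < r -> `|z - z0| < r -> `|cval t z| <= K * r.
Proof.
exists (d%:R * `|jac| + 1 + `|cshift|).
  by rewrite ltr_wpDr// ltr_wpDl// mulr_ge0.
apply: filterS2 (cval_strict ltr01) (nbhs_right_gt 0).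
move=> r S1 r0 t z /andP[t0 tr] zr.
have z0r : `|z0 - z0| < r by rewrite subrr normr0.
have := S1 t z z0 _ zr z0r; rewrite t0 tr => /(_ isT) B.
have := ler_norm_mulmx jac (z - z0) => B2.
have -> : cval t z = cval t z - cval t z0 - jac *m (z - z0)
    + jac *m (z - z0) + cval t z0 by rewrite !subrK.
rewrite (le_trans (ler_normD _ _))// !mulrDl mul1r lerD//; last first.
  by rewrite cval_at_z0 normrZ gtr0_norm// mulrC ler_wpM2l// ltW.
rewrite (le_trans (ler_normD _ _))// addrC lerD//.
  by rewrite (le_trans B2)// ler_wpM2l ?mulr_ge0// ltW.
by rewrite (le_trans B)// mul1r ltW.
Qed.

(** The real arithmetic of [quadratic_growth], with [a = |w|], [j = |J w|] and
    [C] the norm of the active constraint values: since [j] is at most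
    [C + e1 (t + a)], the losses [t Z j] and [k j ^ 2 / 2] cost at most
    [(Z t + k C) C <= s C], which the slack pays, plus small multiples of
    [t ^ 2 + a ^ 2]. *)
Lemma growth_arith (F L V p h t a j C S s k Z e1 e : R) :
  0 < t -> 0 <= a -> 0 <= j -> 0 <= C -> 0 < k -> 0 <= Z -> 0 < e1 <= 1 ->
  e1 * (1 + 2 * Z + 2 * k) <= e -> e1 * (1 + 2 * Z + 2 * k) <= k^-1 / 4 ->
  F = L + S -> s * C <= S ->
  `|L - (V + t * p + 2^-1 * h)| <= e1 * (t ^+ 2 + a ^+ 2) ->
  j <= C + e1 * (t + a) -> - (Z * j) <= p -> k^-1 * a ^+ 2 <= h + k * j ^+ 2 ->
  Z * t + k * C <= s ->
  V + k^-1 / 4 * a ^+ 2 - e * t ^+ 2 <= F.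
Proof.
move=> t0 a0 j0 C0 k0 Z0 /andP[e10 e11] Ae Ak -> SC.
rewrite ler_norml => /andP[L1 _] jC pj ha ZkC.
have tp : - (t * (Z * j)) <= t * p by rewrite -mulrN ler_wpM2l// ltW.
have tZ0 : 0 <= t * Z by rewrite mulr_ge0// ltW.
have tZj : t * (Z * j) <= t * Z * C + Z * e1 * (2 * t ^+ 2 + a ^+ 2).
  have : t * Z * j <= t * Z * (C + e1 * (t + a)) by rewrite ler_wpM2l.
  have Ze : 0 <= Z * e1 by rewrite mulr_ge0// ltW.
  have : Z * e1 * (t * (t + a)) <= Z * e1 * (2 * t ^+ 2 + a ^+ 2).
    by rewrite ler_wpM2l//; have := sqr_ge0 (t - a); have := sqr_ge0 a; nra.
  by lra.
have jj : j ^+ 2 <= 2 * C ^+ 2 + 4 * e1 * (t ^+ 2 + a ^+ 2).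
  have : j ^+ 2 <= (C + e1 * (t + a)) ^+ 2.
    by apply: lerXn2r; rewrite ?nnegrE// (le_trans j0).
  have e1e : e1 ^+ 2 * (t + a) ^+ 2 <= e1 * (2 * (t ^+ 2 + a ^+ 2)).
    apply: ler_pM; rewrite ?sqr_ge0//; first by rewrite expr2 ler_piMl// ltW.
    by have := sqr_ge0 (t - a); lra.
  have := sqr_ge0 (C - e1 * (t + a)); lra.
have kj : k * j ^+ 2 <= k * (2 * C ^+ 2 + 4 * e1 * (t ^+ 2 + a ^+ 2)).
  by rewrite ler_wpM2l// ltW.
have CC : (Z * t + k * C) * C <= s * C by rewrite ler_wpM2r.
have Ze0 : 0 <= Z * e1 * a ^+ 2 by rewrite !mulr_ge0 ?sqr_ge0// ltW.
have At := ler_wpM2r (sqr_ge0 t) Ae.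
have Aa := ler_wpM2r (sqr_ge0 a) Ak.
lra.
Qed.

(** Feasible points off the tangent line pay quadratically: the lower bound of
    the squeeze. *)
Lemma quadratic_growth : exists2 mu, 0 < mu & forall e : R, 0 < e ->
  \forall r \near 0^'+, forall t z, 0 < t < r -> `|z - z0| < r -> feas t z ->
    value2 t + mu * `|z - z0 - t *: dz| ^+ 2 - e * t ^+ 2 <= interp f0 f1 t z.
Proof.
have [s s0 slack] := slack_bound.
have [k k0 finsler] := definite_on_kernel definite.
have [K K0 cK] := cval_bound.
have ki0 : 0 < k^-1 / 4 by rewrite divr_gt0// invr_gt0.
exists (k^-1 / 4) => // e e0.
pose Z := n%:R * `|zeta|; have Z0 : 0 <= Z by rewrite mulr_ge0.
pose A := 1 + 2 * Z + 2 * k; have A0 : 0 < A by rewrite /A; lra.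
pose m := Num.min e (k^-1 / 4); have m0 : 0 < m by rewrite lt_min e0.
pose e1 := Num.min 1 (m / A).
have e10 : 0 < e1 by rewrite lt_min ltr01 divr_gt0.
have e11 : e1 <= 1 by rewrite ge_min lexx.
have e1A : e1 * A <= m by rewrite -ler_pdivlMr// ge_min lexx orbT.
have ZK0 : 0 < Z + k * K by rewrite ltr_wpDl// mulr_gt0.
have n4 : \forall r \near 0^'+, r < s / (Z + k * K).
  by apply: nbhs_right_lt; rewrite divr_gt0.
have n1 := lag_expand e10; have n2 := cval_expand e10.
apply: filterS2 (filterI n1 n2) (filterI cK n4).
move=> r [S1 S2] [S3 S4] t z tr zr fz; have /andP[t0 tr'] := tr.
apply: (@growth_arith _ _ _ (dotv (z - z0 - t *: dz) (H *m dz + q)) _ t _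
  `|jac *m (z - z0 - t *: dz)| `|cval t z| _ s k Z e1 e
  _ _ _ _ _ _ _ _ _ (relaxation_gap t z) (slack t z fz) (S1 t z tr zr)).
all: rewrite ?e10//.
- by rewrite (le_trans e1A)// ge_min lexx.
- by rewrite (le_trans e1A)// ge_min lexx orbT.
- have := ler_distD (cval t z) 0 (jac *m (z - z0 - t *: dz)).
  rewrite !sub0r !normrN => /le_trans; apply.
  by rewrite lerD2l; exact: S2.
- rewrite stationary_dz dotvNr lerN2.
  have -> : dotv (z - z0 - t *: dz) (jac^T *m zeta) =
      dotv zeta (jac *m (z - z0 - t *: dz)).
    by rewrite dotvC /dotv trmx_mul trmxK -mulmxA.
  by rewrite (le_trans (ler_norm _))// ler_norm_dotv.
- have B := S3 t z tr zr.
  have : r * (Z + k * K) <= s by rewrite -ler_pdivlMr// ltW.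
  have : Z * t <= Z * r by rewrite ler_wpM2l// ltW.
  have : k * `|cval t z| <= k * (K * r) by rewrite ler_wpM2l// ltW.
  lra.
Qed.

Variable N : 'M[R]_(d, n).
Hypothesis licq : forall i (y : 'cV[R]_n), active i ->
  (jac *m (N *m y)) i 0 = y i 0.

(** The active equations along [z0 + t dz + N y] are a perturbation of the
    identity in [y], with residual [o(t)] at [y = 0]; a half-contraction
    corrects the tangent line to a point that satisfies them exactly. *)
Lemma active_curve (e : R) : 0 < e -> \forall t \near 0^'+,
  exists2 z, cval t z = 0 & `|z - z0 - t *: dz| <= e * t.
Proof.
move=> e0; pose B := n%:R * `|N| + 1.
have B0 : 0 < B by rewrite ltr_wpDl// mulr_ge0.
have NB (y : 'cV[R]_n) : `|N *m y| <= B * `|y|.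
  by rewrite (le_trans (ler_norm_mulmx _ _))// ler_wpM2r// lerDl.
pose e1 := (2 * B)^-1; have e10 : 0 < e1 by rewrite invr_gt0 mulr_gt0.
pose e2 := e / (2 * B); have e20 : 0 < e2 by rewrite divr_gt0// mulr_gt0.
pose D := `|dz|; have D0 : 0 <= D by exact: normr_ge0.
near (0 : R)^'+ => r.
have r0 : 0 < r by [].
have S1 : forall t x y, 0 < t < r -> `|x - z0| < r -> `|y - z0| < r ->
    `|cval t x - cval t y - jac *m (x - y)| <= e1 * `|x - y|.
  by near: r; exact: cval_strict.
have S2 : forall t z, 0 < t < r -> `|z - z0| < r ->
    `|cval t z - jac *m (z - z0 - t *: dz)|
      <= e2 * (t + `|z - z0 - t *: dz|).
  by near: r; exact: cval_expand.
(* For [|y| <= rho] the correction [N y] has norm at most [r / 2]. *)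
pose rho := r / (2 * B); have rho0 : 0 < rho by rewrite divr_gt0// mulr_gt0.
near=> t.
have t0 : 0 < t by [].
have tr : t < r by near: t; exact: nbhs_right_lt.
have tD : t * (D + 1) < r / 2.
  rewrite -ltr_pdivlMr ?ltr_wpDl//; near: t; apply: nbhs_right_lt.
  by rewrite !divr_gt0// ltr_wpDl.
have te2 : e2 * t <= rho / 2.
  rewrite mulrC -ler_pdivlMr//; near: t; apply: nbhs_right_le.
  by apply: divr_gt0 => //; exact: divr_gt0.
have t0r : 0 < t < r by rewrite t0.
pose x (y : 'cV[R]_n) := z0 + t *: dz + N *m y.
have xr y : `|y| <= rho -> `|x y - z0| < r.
  move=> yr; have -> : x y - z0 = t *: dz + N *m y.
    by rewrite /x -(addrA z0) (addrC z0) addrK.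
  rewrite (le_lt_trans (ler_normD _ _))// normrZ gtr0_norm//.
  have : B * `|y| <= B * rho by rewrite ler_wpM2l// ltW.
  have -> : B * rho = r / 2 by rewrite /rho; field; rewrite gt_eqF.
  by have := NB y; rewrite -/D; lra.
have xB y y' : x y - x y' = N *m (y - y').
  by rewrite /x opprD addrACA subrr add0r mulmxBr.
pose Phi y := jac *m (N *m y) - cval t (x y).
have Phi0 : `|Phi 0| <= e2 * t.
  have xz : x 0 - z0 - t *: dz = 0.
    by rewrite /x mulmx0 addr0 (addrC z0) addrK subrr.
  have := S2 t (x 0) t0r; rewrite xz mulmx0 subr0 normr0 addr0 => S.
  rewrite /Phi !mulmx0 sub0r normrN; apply: S; apply: xr.
  by rewrite normr0 ltW.
have [||y yP Phiy] := @half_contraction_fixpoint _ _ Phi rho.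
- move=> y y' yr yr'; rewrite -normrN.
  have -> : - (Phi y - Phi y') =
      cval t (x y) - cval t (x y') - jac *m (x y - x y').
    rewrite xB /Phi (mulmxBr N) (mulmxBr jac).
    move: (cval t (x y)) (cval t (x y')) (jac *m (N *m y)) (jac *m (N *m y')).
    by move=> ? ? ? ?; apply/colP => i; rewrite !mxE; ring.
  rewrite (le_trans (S1 t _ _ t0r (xr _ yr) (xr _ yr')))// xB.
  have := ler_wpM2l (ltW e10) (NB (y - y')) => /le_trans; apply.
  by rewrite mulrA /e1 invfM divfK// gt_eqF.
- exact: le_trans Phi0 te2.
exists (x y).
  apply/colP => i; rewrite [RHS]mxE; have [ai|ai] := boolP (active i); last first.
    by rewrite mxE (negbTE ai).
  have -> : cval t (x y) = jac *m (N *m y) - Phi y by rewrite /Phi subKr.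
  by rewrite Phiy mxE licq// mxE subrr.
have -> : x y - z0 - t *: dz = N *m y.
  by rewrite /x -(addrA z0) (addrC z0) addrK (addrC (t *: dz)) addrK.
rewrite (le_trans (NB y))//.
have : B * `|y| <= B * (2 * (e2 * t)).
  by rewrite ler_wpM2l ?(ltW B0)// (le_trans yP)// ler_wpM2l.
move=> /le_trans; apply; rewrite /e2 le_eqVlt; apply/orP; left; apply/eqP.
by field; rewrite gt_eqF.
Unshelve. all: by end_near. Qed.

(** On points where the active constraints vanish exactly, the relaxation is
    tight; inactive inequalities stay strict near [z0]. *)
Lemma active_curve_feasible : \forall r \near 0^'+, forall t z,
  0 < t < r -> `|z - z0| < r -> cval t z = 0 ->
  feas t z /\ interp f0 f1 t z = lag z + t * dlag z.
Proof.
pose Q i r := forall t z, 0 < t < r -> `|z - z0| < r -> ~~ active i ->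
  interp (c0 i) (c1 i) t z <= 0.
have nQ : \forall r \near 0^'+, forall i, Q i r.
  apply: (@filter_forall _ _ Q) => i.
  have [ai|ai] := boolP (active i); first by near=> r => t z _ _ /negP.
  move: (ai); rewrite negb_or => /andP[nE c0i].
  have cz : c0 i z0 < 0.
    have [_ /(_ nE)] := feas0 i; rewrite interp0 => le0.
    by rewrite lt_neqAle c0i.
  have := interp_near z0 (C2_continuous (C2c0 i))
    (C2_continuous (C2c1 i)) (e := - c0 i z0); rewrite oppr_gt0 => /(_ cz).
  apply: filterS => r S t z tr zr _; have := S t z tr zr.
  by rewrite ler_norml => /andP[_]; lra.
apply: filterS nQ => r Qr t z tr zr cz.
have act i : active i -> interp (c0 i) (c1 i) t z = 0.
  by move=> ai; move/colP/(_ i): cz; rewrite !mxE ai.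
split=> [i|].
  split=> [Ei|nE]; first by apply: act; rewrite /active Ei.
  have [/act ->//|ai] := boolP (active i); exact: Qr ai.
rewrite relaxation_gap big1 ?addr0// => i _.
have [/act ->|/lam_inactive ->] := boolP (active i).
  by rewrite mulr0 oppr0.
by rewrite mul0r oppr0.
Unshelve. all: by end_near. Qed.

Lemma value_upper_bound (e : R) : 0 < e -> \forall t \near 0^'+,
  exists2 z, feas t z & interp f0 f1 t z <= value2 t + e * t ^+ 2.
Proof.
move=> e0; set p := H *m dz + q.
pose C := d%:R * `|p| + d%:R * (d%:R * `|H|) + 2.
have C0 : 0 < C by rewrite ltr_wpDl// addr_ge0// !mulr_ge0.
pose e1 := Num.min 1 (e / C).
have e10 : 0 < e1 by rewrite lt_min ltr01 divr_gt0.
have e11 : e1 <= 1 by rewrite ge_min lexx.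
have e1C : e1 * C <= e by rewrite -ler_pdivlMr// ge_min lexx orbT.
have D0 : 0 <= `|dz| by exact: normr_ge0.
near (0 : R)^'+ => r.
have r0 : 0 < r by [].
have S1 : forall t z, 0 < t < r -> `|z - z0| < r -> cval t z = 0 ->
    feas t z /\ interp f0 f1 t z = lag z + t * dlag z.
  by near: r; exact: active_curve_feasible.
have S2 : forall t z, 0 < t < r -> `|z - z0| < r ->
    let w := z - z0 - t *: dz in
    `|lag z + t * dlag z
      - (value2 t + t * dotv w (H *m dz + q) + 2^-1 * dotv w (H *m w))|
      <= e1 * (t ^+ 2 + `|w| ^+ 2).
  by near: r; exact: lag_expand.
near=> t.
have t0 : 0 < t by [].
have tr : 0 < t < r by rewrite t0; near: t; exact: nbhs_right_lt.
have tD : t * (`|dz| + 1) < r.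
  rewrite -ltr_pdivlMr ?ltr_wpDl//; near: t; apply: nbhs_right_lt.
  by rewrite divr_gt0// ltr_wpDl.
have [z cz wt] : exists2 z, cval t z = 0 & `|z - z0 - t *: dz| <= e1 * t.
  by near: t; exact: active_curve.
have zr : `|z - z0| < r.
  have := ler_normD (z - z0 - t *: dz) (t *: dz).
  rewrite subrK normrZ gtr0_norm//.
  have : e1 * t <= t by rewrite ler_piMl// ltW.
  lra.
have [fz ftz] := S1 t z tr zr cz; exists z; rewrite ?ftz//.
have := S2 t z tr zr; rewrite -/p /=.
set w := z - z0 - t *: dz in wt *.
have W0 : 0 <= `|w| by exact: normr_ge0.
rewrite ler_norml => /andP[_ B].
have W2 : `|w| ^+ 2 <= e1 * t ^+ 2.
  have : `|w| ^+ 2 <= (e1 * t) ^+ 2.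
    by apply: lerXn2r; rewrite ?nnegrE ?mulr_ge0 ?(ltW e10) ?(ltW t0).
  move=> /le_trans; apply; rewrite exprMn ler_wpM2r ?sqr_ge0//.
  by rewrite expr2 ler_piMl// ltW.
have B1 : t * dotv w p <= d%:R * `|p| * (e1 * t ^+ 2).
  have -> : d%:R * `|p| * (e1 * t ^+ 2) = t * (d%:R * (e1 * t) * `|p|) by ring.
  rewrite ler_wpM2l ?(ltW t0)// (le_trans (ler_norm _))//.
  rewrite (le_trans (ler_norm_dotv _ _))// ler_wpM2r// ler_wpM2l//.
have B2 : dotv w (H *m w) <= d%:R * (d%:R * `|H|) * (e1 * t ^+ 2).
  rewrite (le_trans (ler_norm _))// (le_trans (ler_norm_dotv _ _))//.
  have : d%:R * `|w| * `|H *m w| <= d%:R * `|w| * (d%:R * `|H| * `|w|).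
    by rewrite ler_wpM2l ?mulr_ge0// ler_norm_mulmx.
  move=> /le_trans; apply.
  have -> : d%:R * `|w| * (d%:R * `|H| * `|w|) =
     d%:R * (d%:R * `|H|) * `|w| ^+ 2 by ring.
  by rewrite ler_wpM2l// !mulr_ge0.
have B3 : e1 * (t ^+ 2 + `|w| ^+ 2) <= 2 * (e1 * t ^+ 2).
  rewrite mulrDr mulr2n mulrDl mul1r lerD2l ler_wpM2l ?(ltW e10)//.
  by rewrite (le_trans W2)// ler_piMl// sqr_ge0.
have := ler_wpM2r (sqr_ge0 t) e1C.
have : 0 <= d%:R * (d%:R * `|H|) * (e1 * t ^+ 2).
  by rewrite !mulr_ge0// ?(ltW e10)// ?(ltW t0).
rewrite /C; lra.
Unshelve. all: by end_near. Qed.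

Lemma value2_near (e : R) : 0 < e -> \forall r \near 0^'+,
  forall t, 0 < t < r -> value2 t + t ^+ 2 <= f0 z0 + e.
Proof.
move=> e0; pose b := 2^-1 * dotv dz (H *m dz) + dotv dz q.
pose K := `|dlag z0| + `|b| + 1.
have K0 : 0 < K by rewrite ltr_wpDl// addr_ge0.
near=> r => t /andP[t0 tr].
have t1 : t < 1 by rewrite (lt_le_trans tr)//; near: r; exact: nbhs_right_le.
have tK : t * K <= e.
  rewrite -ler_pdivlMr// ltW// (lt_le_trans tr)//; near: r.
  by apply: nbhs_right_le; rewrite divr_gt0.
rewrite /value2 -/b -addrA -addrA lerD2l (le_trans _ tK)//.
have := ler_wpM2l (ltW t0) (ler_norm (dlag z0)).
have t2 : t ^+ 2 <= t by rewrite expr2 ler_piMl// ltW.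
have : t ^+ 2 * b <= t * `|b|.
  rewrite (le_trans (ler_norm _))// normrM (ger0_norm (sqr_ge0 t)).
  by rewrite ler_wpM2r.
by rewrite /K; lra.
Unshelve. all: by end_near. Qed.

Hypothesis z0_unique : forall z, feas 0 z -> f0 z <= f0 z0 -> z = z0.

(** Points away from [z0] violate a constraint or the value bound at [t = 0]
    with a margin that persists nearby; compactness makes it uniform. *)
Lemma near_optimal_near_z0 (M rho : R) : 0 < rho -> \forall t \near 0^'+,
  forall z, `|z| <= M -> feas t z ->
    interp f0 f1 t z <= value2 t + t ^+ 2 -> `|z - z0| < rho.
Proof.
move=> rho0.
have from_radius (x : 'cV[R]_d) (Q : R -> 'cV[R]_d -> Prop) :
    (\forall r \near 0^'+, forall t z, 0 < t < r -> `|z - x| < r -> Q t z) ->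
    \forall z \near x & t \near 0^'+, Q t z.
  move=> nQ; near (0 : R)^'+ => r.
  have r0 : 0 < r by [].
  have S : forall t z, 0 < t < r -> `|z - x| < r -> Q t z by near: r.
  exists (ball x r, [set t | 0 < t < r]) => [|[z t] [/= zr tr]].
    split; first exact: nbhsx_ballx.
    by near=> t; apply/andP; split=> //; near: t; exact: nbhs_right_lt.
  by apply: S => //; move: zr; rewrite -ball_normE /= distrC.
have cK := (compact_near_coveringP _).1 (@cV_closed_ball_compact R d M).
apply: (cK R (at_right 0) (fun t z => feas t z ->
    interp f0 f1 t z <= value2 t + t ^+ 2 -> `|z - z0| < rho)) => x _.
apply: from_radius.
have [->|xz0] := eqVneq x z0.
  near=> r => t z _ zr _ _; rewrite (lt_le_trans zr)//.
  by near: r; exact: nbhs_right_le.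
have [fx|nfx] := pselect (feas 0 x).
  have gap : 0 < (f0 x - f0 z0) / 3.
    rewrite divr_gt0// subr_gt0 ltNge; apply/negP => /(z0_unique fx)/eqP.
    by rewrite (negbTE xz0).
  have n1 := interp_near x (C2_continuous C2f0) (C2_continuous C2f1) gap.
  apply: filterS2 n1 (value2_near gap) => r S1 S2 t z tr zr _.
  have := S1 t z tr zr; have := S2 t tr.
  by rewrite ler_norml => B /andP[B1 _] B2; exfalso; move: gap; lra.
have [i nfi] : exists i, ~ ((E i -> c0 i x = 0) /\ (~~ E i -> c0 i x <= 0)).
  apply: contrapT => /forallNP fx; apply: nfx => i; rewrite interp0.
  exact: contrapT (fx i).
have margin : exists2 e, 0 < e & forall t z,
    `|interp (c0 i) (c1 i) t z - c0 i x| <= e -> ~ feas t z.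
  have [Ei|nE] := boolP (E i).
    have cx : 0 < `|c0 i x|.
      by rewrite normr_gt0; apply/eqP => cx; apply: nfi; rewrite Ei.
    exists (`|c0 i x| / 2); first by rewrite divr_gt0.
    by move=> t z B /(_ i) [/(_ Ei) cz _]; move: B; rewrite cz sub0r normrN; lra.
  have cx : 0 < c0 i x.
    by rewrite ltNge; apply/negP => cx; apply: nfi; rewrite (negbTE nE).
  exists (c0 i x / 2); first by rewrite divr_gt0.
  by move=> t z + /(_ i) [_ /(_ nE)]; rewrite ler_norml => /andP[]; lra.
have [e e0 eP] := margin.
have := interp_near x (C2_continuous (C2c0 i)) (C2_continuous (C2c1 i)) e0.
apply: filterS => r S t z tr zr fz; exfalso.
exact: eP (S t z tr zr) fz.
Unshelve. all: by end_near. Qed.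

Lemma interp_continuous (F G : 'cV[R]_d -> R) t :
  C2 F -> C2 G -> continuous (interp F G t).
Proof.
move=> cF cG; apply: continuous_lin; first exact: C2_continuous.
exact: (C2_continuous (C2B cG cF)).
Qed.

(** The level set is compact. *)
Lemma argmin_exists t (alpha M : R) :
  feas t `&` [set z | interp f0 f1 t z <= alpha] !=set0 ->
  (forall z, feas t z -> interp f0 f1 t z <= alpha -> `|z| <= M) ->
  argmin (interp f0 f1 t) (feas t) !=set0.
Proof.
move=> L0 LM; set L := _ `&` _ in L0.
have cL : closed L.
  have cle (F : 'cV[R]_d -> R) b : continuous F -> closed [set z | F z <= b].
    move=> cF; apply: (@closed_comp _ _ F [set x | x <= b]); last exact: closed_le.
    by move=> z _; exact: cF.
  apply: closedI; last exact/cle/interp_continuous.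
  have -> : feas t = \bigcap_(i in [set: 'I_n])
      [set z | (E i -> interp (c0 i) (c1 i) t z = 0) /\
               (~~ E i -> interp (c0 i) (c1 i) t z <= 0)].
    by apply/seteqP; split=> [z fz i _|z fz i]; [exact: fz|exact: (fz i I)].
  apply: closed_bigI => i _.
  have ci := interp_continuous (t := t) (C2c0 i) (C2c1 i).
  have [Ei|nE] := boolP (E i).
    have -> : [set z | (true -> interp (c0 i) (c1 i) t z = 0) /\
                       (~~ true -> interp (c0 i) (c1 i) t z <= 0)] =
        [set z | interp (c0 i) (c1 i) t z = 0].
      by apply/seteqP; split=> z /=; [case=> /(_ isT)|move=> ->].
    apply: (@closed_comp _ _ _ [set x | x = 0]); last exact: closed_eq.
    by move=> z _; exact: ci.
  have -> : [set z | (false -> interp (c0 i) (c1 i) t z = 0) /\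
                     (~~ false -> interp (c0 i) (c1 i) t z <= 0)] =
      [set z | interp (c0 i) (c1 i) t z <= 0].
    by apply/seteqP; split=> z /=; [case=> _ /(_ isT)|].
  exact: cle.
have bL : bounded_set L.
  exists M; split=> [|b Mb z [fz zL] /=]; first exact: num_real.
  by rewrite (le_trans (LM z fz zL))// ltW.
have ct := continuous_subspaceT (A := L) (interp_continuous (t := t) C2f0 C2f1).
have [z] := compact_EVT_min L0 (cV_bounded_closed_compact bL cL) ct.
rewrite inE => -[fz zL] zmin; exists z; split=> // y fy.
have [yL|/ltW yL] := leP (interp f0 f1 t y) alpha.
  by apply: zmin; rewrite inE.
exact: le_trans zL yL.
Qed.

(** Squeeze between the value of the corrected tangent line and the growth
    of the perturbed problem around it. *)
Lemma perturbed_minimizer_expansion (M e : R) : 0 < e -> \forall t \near 0^'+,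
  forall z, argmin (interp f0 f1 t) (feas t) z -> `|z| <= M ->
    `|interp f0 f1 t z - value2 t| <= e * t ^+ 2 /\
    `|z - z0 - t *: dz| <= e * t.
Proof.
move=> e0; have [mu mu0 growth] := quadratic_growth.
(* [mu |w| ^ 2 <= 2 e1 t ^ 2] has to give [|w| <= e t]. *)
pose e1 := Num.min 1 (Num.min e (mu * e ^+ 2 / 2)).
have e10 : 0 < e1.
  by rewrite !lt_min ltr01 e0 divr_gt0// mulr_gt0// exprn_gt0.
have e11 : e1 <= 1 by rewrite ge_min lexx.
have e1e : e1 <= e by rewrite !ge_min lexx orbT.
have e1mu : e1 <= mu * e ^+ 2 / 2 by rewrite !ge_min lexx !orbT.
near (0 : R)^'+ => r.
have r0 : 0 < r by [].
have S1 : forall t z, 0 < t < r -> `|z - z0| < r -> feas t z ->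
    value2 t + mu * `|z - z0 - t *: dz| ^+ 2 - e1 * t ^+ 2 <= interp f0 f1 t z.
  by near: r; exact: growth.
near=> t.
have t0 : 0 < t by [].
have tr : 0 < t < r by rewrite t0; near: t; exact: nbhs_right_lt.
have [y fy yle] : exists2 z, feas t z &
    interp f0 f1 t z <= value2 t + e1 * t ^+ 2.
  by near: t; exact: value_upper_bound.
have loc : forall z, `|z| <= M -> feas t z ->
    interp f0 f1 t z <= value2 t + t ^+ 2 -> `|z - z0| < r.
  by near: t; exact: near_optimal_near_z0.
move=> z [fz zmin] zM.
have t20 : 0 <= t ^+ 2 by exact: sqr_ge0.
have zle : interp f0 f1 t z <= value2 t + e1 * t ^+ 2.
  by rewrite (le_trans (zmin y fy)).
have zr : `|z - z0| < r.
  by apply: loc => //; rewrite (le_trans zle)// lerD2l ler_piMl.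
have lo := S1 t z tr zr fz.
set w := `|z - z0 - t *: dz| in lo *.
have w0 : 0 <= w by exact: normr_ge0.
have w20 : 0 <= mu * w ^+ 2 by rewrite mulr_ge0 ?sqr_ge0// ltW.
have e1t : e1 * t ^+ 2 <= e * t ^+ 2 by rewrite ler_wpM2r.
split; first by rewrite ler_norml; apply/andP; split; lra.
have e1t' : e1 * t ^+ 2 <= mu * e ^+ 2 / 2 * t ^+ 2 by rewrite ler_wpM2r.
have : mu * w ^+ 2 <= mu * (e * t) ^+ 2 by lra.
rewrite ler_pM2l// ler_pXn2r ?nnegrE// mulr_ge0// ltW.
Unshelve. all: by end_near. Qed.


End Expansions.

End PerturbedProgram.

(** * Multipliers and the KKT system *)

Definition joint (T : Type) m m' (g : 'I_m -> T) (h : 'I_m' -> T)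
    (i : 'I_(m + m')) : T :=
  match fintype.split i with inl k => g k | inr k => h k end.

Lemma jointl (T : Type) m m' (g : 'I_m -> T) (h : 'I_m' -> T) k :
  joint g h (lshift m' k) = g k.
Proof. by rewrite /joint -[lshift m' k]/(unsplit (inl k)) unsplitK. Qed.

Lemma jointr (T : Type) m m' (g : 'I_m -> T) (h : 'I_m' -> T) k :
  joint g h (rshift m k) = h k.
Proof. by rewrite /joint -[rshift m k]/(unsplit (inr k)) unsplitK. Qed.

Definition jointE := (jointl, jointr).

Lemma joint_feasE (R : realType) (d m m' s s' : nat)
    (g0 gj : 'I_m -> 'cV[R]_d -> R) (h : 'I_m' -> 'cV[R]_d -> R) t :
  feas (joint g0 h) (joint gj h)
    (joint (fun k : 'I_m => (k < s)%N) (fun k : 'I_m' => (k < s')%N)) t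
  = feasible s s' g0 gj h t.
Proof.
have hE k z : interp (h k) (h k) t z = h k z by rewrite /interp subrr mulr0 addr0.
apply/seteqP; split=> z /=.
  move=> fz; split=> k.
  - by have := (fz (lshift m' k)).1; rewrite !jointE.
  - by have := (fz (lshift m' k)).2; rewrite !jointE -leqNgt.
  - by have := (fz (rshift m k)).1; rewrite !jointE hE.
  - by have := (fz (rshift m k)).2; rewrite !jointE hE -leqNgt.
move=> [g1 g2 h1 h2] i; case: (split_ordP i) => k ->; rewrite !jointE.
  by split=> [/g1//|]; rewrite -leqNgt => /g2.
by rewrite hE; split=> [/h1//|]; rewrite -leqNgt => /h2.
Qed.

Lemma joint_lagE (R : realType) (d m m' : nat) (f0 : 'cV[R]_d -> R)
    (g0 : 'I_m -> 'cV[R]_d -> R) (h : 'I_m' -> 'cV[R]_d -> R) lam nu :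
  lagrangian f0 g0 h lam nu = lag f0 (joint g0 h) (col_mx lam nu).
Proof.
apply/funext => z; rewrite /lagrangian /lag big_split_ord /= addrA.
by congr (_ + _ + _); apply: eq_bigr => k _; rewrite jointE ?col_mxEu ?col_mxEd.
Qed.

Lemma in_active_set (R : realType) d m s (g : 'I_m -> 'cV[R]_d -> R) z0 k :
  (k \in active_set s g z0) = (k < s)%N || (g k z0 == 0).
Proof. by rewrite !inE; case: (ltnP k s). Qed.

Lemma joint_activeE (R : realType) (d m m' s s' : nat)
    (g : 'I_m -> 'cV[R]_d -> R) (h : 'I_m' -> 'cV[R]_d -> R) z0 i :
  active (joint g h)
    (joint (fun k : 'I_m => (k < s)%N) (fun k : 'I_m' => (k < s')%N)) z0 i
  = joint (fun k => k \in active_set s g z0)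
          (fun k => k \in active_set s' h z0) i.
Proof.
by rewrite /active; case: (split_ordP i) => k ->; rewrite !jointE in_active_set.
Qed.

Lemma trmx_jacE (R : realType) d n (c : 'I_n -> 'cV[R]_d -> R) E z0 y :
  (jac c E z0)^T *m y =
  \sum_i (if active c E z0 i then y i 0 else 0) *: grad (c i) z0.
Proof.
apply/colP => l; rewrite mxE summxE; apply: eq_bigr => i _; rewrite !mxE.
by case: ifP; rewrite ?mul0r// mulrC.
Qed.

(** Adding to [lam] a small multiple of a dependency of the active gradients
    gives another multiplier, because the active inequality multipliers are
    bounded away from zero. *)
Lemma unique_multiplier_licq (R : realType) d n (f0 : 'cV[R]_d -> R)
    (c : 'I_n -> 'cV[R]_d -> R) (E : pred 'I_n) z0 (lam : 'cV[R]_n) :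
  C2 f0 -> (forall i, C2 (c i)) ->
  grad (lag f0 c lam) z0 = 0 ->
  (forall i, ~~ active c E z0 i -> lam i 0 = 0) ->
  (forall i, ~~ E i -> active c E z0 i -> 0 < lam i 0) ->
  (forall lam' : 'cV[R]_n, grad (lag f0 c lam') z0 = 0 ->
     (forall i, ~~ active c E z0 i -> lam' i 0 = 0) ->
     (forall i, ~~ E i -> 0 <= lam' i 0) -> lam' = lam) ->
  forall y : 'cV[R]_n, (jac c E z0)^T *m y = 0 ->
    forall i, active c E z0 i -> y i 0 = 0.
Proof.
move=> C2f C2c gL lam0 lampos uniq y Jy.
pose u : 'cV[R]_n := \col_i if active c E z0 i then y i 0 else 0.
have gradE l : grad (lag f0 c l) z0 = grad f0 z0 + \sum_i l i 0 *: grad (c i) z0.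
  exact: (grad_lin_sum _ (fun i => l i 0) z0 C2f C2c).
pose e := \big[Num.min/(1:R)]_(i | ~~ E i && active c E z0 i)
  (lam i 0 / (`|u i 0| + 1)).
have e0 : 0 < e.
  rewrite /e; elim/big_ind: _ => // [a b a0 b0|i /andP[nE ai]].
    by rewrite lt_min a0.
  by rewrite divr_gt0 ?lampos// ltr_wpDl.
have luE i : (lam + e *: u) i 0 = lam i 0 + e * u i 0.
  by rewrite mxE; congr (_ + _); rewrite mxE.
have uout i : ~~ active c E z0 i -> u i 0 = 0.
  by move=> ai; rewrite mxE (negbTE ai).
have /colP lamu : lam + e *: u = lam.
  apply: uniq => [|i ai|i nE].
  - rewrite gradE; move: Jy; rewrite trmx_jacE => Jy.
    have -> : \sum_i (lam + e *: u) i 0 *: grad (c i) z0 =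
        \sum_i lam i 0 *: grad (c i) z0 + e *: \sum_i u i 0 *: grad (c i) z0.
      rewrite scaler_sumr -big_split /=; apply: eq_bigr => i _.
      by rewrite luE scalerDl scalerA.
    rewrite addrA -gradE gL add0r.
    by under eq_bigr do rewrite mxE; rewrite Jy scaler0.
  - by rewrite luE uout// lam0// mulr0 addr0.
  - have [ai|ai] := boolP (active c E z0 i); last first.
      by rewrite luE uout// lam0// mulr0 addr0.
    have ui : 0 < `|u i 0| + 1 by rewrite ltr_wpDl.
    have : e <= lam i 0 / (`|u i 0| + 1).
      by apply: bigmin_le_cond; rewrite nE ai.
    rewrite ler_pdivlMr// => eu.
    have : - (e * `|u i 0|) <= e * u i 0.
      by rewrite -mulrN ler_wpM2l ?(ltW e0)// lerNl -normrN ler_norm.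
    by rewrite luE; lra.
move=> i ai; have := lamu i; rewrite luE [u i 0]mxE ai => /eqP.
by rewrite -subr_eq0 addrC addKr mulf_eq0 gt_eqF //= => /eqP.
Qed.

(** Independence of the rows in [act] means that the coordinate projections in
    [act] vanish on the left kernel of [J], so that they factor through
    [J]. *)
Lemma partial_right_inverse (R : realType) n d (J : 'M[R]_(n, d))
    (act : pred 'I_n) :
  (forall y : 'cV[R]_n, J^T *m y = 0 -> forall i, act i -> y i 0 = 0) ->
  exists N : 'M[R]_(d, n),
    forall i (y : 'cV[R]_n), act i -> (J *m (N *m y)) i 0 = y i 0.
Proof.
move=> ker; pose D : 'M[R]_n := \matrix_(i, k) ((i == k) && act i)%:R.
have symD : D^T = D.
  by apply/matrixP => i k; rewrite !mxE eq_sym; case: eqP => // ->.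
have DE p (B : 'M[R]_(n, p)) i j : (D *m B) i j = if act i then B i j else 0.
  rewrite mxE (bigD1 i) //= big1 ?addr0 => [|k ki]; rewrite mxE.
    by rewrite eqxx /=; case: (act i); rewrite ?mul1r ?mul0r.
  by rewrite eq_sym (negbTE ki) mul0r.
have /submxP[W DW] : (D <= J^T)%MS.
  rewrite submxE; move: (cokermx _) (mulmx_coker J^T) => C JC.
  apply/eqP/matrixP => i j; rewrite DE [RHS]mxE; case: ifP => // ai.
  have JCj : J^T *m col j C = 0 by rewrite colE mulmxA JC mul0mx.
  by have := ker _ JCj i ai; rewrite mxE.
exists W^T => i y ai; rewrite mulmxA -[J]trmxK -trmx_mul -DW symD DE.
by rewrite ai.
Qed.

(** Extension by zero of a multiplier indexed by the active set only. *)
Definition spread (R : realType) m (K : {set 'I_m}) (u : 'cV[R]_#|K|) : 'cV[R]_m :=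
  \col_k \sum_i (enum_val i == k)%:R * u i 0.

Lemma spread_sum (R : realType) d m (K : {set 'I_m}) (u : 'cV[R]_#|K|)
    (a : 'I_m -> 'cV[R]_d) :
  \sum_k spread u k 0 *: a k = \sum_i u i 0 *: a (enum_val i).
Proof.
under eq_bigr do rewrite mxE scaler_suml.
rewrite exchange_big /=; apply: eq_bigr => i _.
rewrite (bigD1 (enum_val i)) //= big1 ?addr0 ?eqxx ?mul1r// => k ki.
by rewrite eq_sym (negbTE ki) mul0r scale0r.
Qed.

Lemma spread_out (R : realType) m (K : {set 'I_m}) (u : 'cV[R]_#|K|) k :
  k \notin K -> spread u k 0 = 0.
Proof.
move=> kK; rewrite mxE big1// => i _; case: eqP => [ik|]; rewrite ?mul0r//.
by move: kK; rewrite -ik enum_valP.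
Qed.

Lemma spread_enum (R : realType) m (K : {set 'I_m}) (u : 'cV[R]_#|K|) i :
  spread u (enum_val i) 0 = u i 0.
Proof.
rewrite mxE (bigD1 i) //= eqxx mul1r big1 ?addr0// => k ki.
by rewrite (inj_eq enum_val_inj) (negbTE ki) mul0r.
Qed.

Lemma trmx_gradmx_mul (R : realType) d m (K : {set 'I_m})
    (g : 'I_m -> 'cV[R]_d -> R) z (u : 'cV[R]_#|K|) :
  (gradmx K g z)^T *m u = \sum_k spread u k 0 *: grad (g k) z.
Proof.
rewrite spread_sum; apply/colP => l; rewrite mxE summxE.
by apply: eq_bigr => i _; rewrite !mxE mulrC.
Qed.

Lemma gradmx_mul (R : realType) d m (K : {set 'I_m})
    (g : 'I_m -> 'cV[R]_d -> R) z x i :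
  (gradmx K g z *m x) i 0 = dotv (grad (g (enum_val i)) z) x.
Proof. by rewrite mxE dotvE; apply: eq_bigr => l _; rewrite !mxE. Qed.

Lemma joint_trmx_jac (R : realType) (d m m' s s' : nat)
    (g : 'I_m -> 'cV[R]_d -> R) (h : 'I_m' -> 'cV[R]_d -> R) z0
    (xi : 'cV[R]_#|active_set s g z0|) (eta : 'cV[R]_#|active_set s' h z0|) :
  (jac (joint g h)
     (joint (fun k : 'I_m => (k < s)%N) (fun k : 'I_m' => (k < s')%N)) z0)^T
    *m col_mx (spread xi) (spread eta) =
  (gradmx (active_set s g z0) g z0)^T *m xi
  + (gradmx (active_set s' h z0) h z0)^T *m eta.
Proof.
rewrite trmx_jacE big_split_ord /= !trmx_gradmx_mul.
congr (_ + _); apply: eq_bigr => k _; rewrite joint_activeE !jointE.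
  by rewrite col_mxEu; case: ifPn => // /spread_out ->.
by rewrite col_mxEd; case: ifPn => // /spread_out ->.
Qed.

Lemma kkt_mulE (R : realType) d a b (H : 'M[R]_d) (A : 'M[R]_(a, d))
    (B : 'M[R]_(b, d))
    (x : 'cV[R]_d) (u : 'cV[R]_a) (v : 'cV[R]_b) :
  kkt_matrix H A B *m col_mx x (col_mx u v) =
  col_mx (H *m x + (A^T *m u + B^T *m v)) (col_mx (A *m x) (B *m x)).
Proof.
rewrite /kkt_matrix mul_block_col mul_row_col mul_col_mx mul0mx addr0.
by [].
Qed.

Lemma mulmx_inj_unitmx (R : realType) n (M : 'M[R]_n) :
  (forall w : 'cV[R]_n, M *m w = 0 -> w = 0) -> M \in unitmx.
Proof.
move=> inj; rewrite -unitmx_tr -row_free_unit -kermx_eq0; apply/eqP.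
apply/row_matrixP => i; rewrite row0; apply: trmx_inj; rewrite trmx0.
apply: inj; apply: trmx_inj; rewrite trmx_mul trmxK trmx0.
by rewrite -row_mul mulmx_ker row0.
Qed.

(** Definiteness on the kernel of the constraints kills the primal part of a
    null vector, independence of the gradients kills the dual part. *)
Lemma kkt_unit (R : realType) d a b (H : 'M[R]_d) (A : 'M[R]_(a, d))
    (B : 'M[R]_(b, d)) :
  (forall x : 'cV[R]_d, A *m x = 0 -> B *m x = 0 -> x != 0 ->
     0 < dotv x (H *m x)) ->
  (forall (u : 'cV[R]_a) (v : 'cV[R]_b), A^T *m u + B^T *m v = 0 ->
     u = 0 /\ v = 0) ->
  kkt_matrix H A B \in unitmx.
Proof.
move=> pos free; apply: mulmx_inj_unitmx => w.
rewrite -[w]vsubmxK -[dsubmx w]vsubmxK.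
set x := usubmx w; set u := usubmx (dsubmx w); set v := dsubmx (dsubmx w).
rewrite kkt_mulE -col_mx0 => /eq_col_mx[Hx]; rewrite -col_mx0 => /eq_col_mx[Ax Bx].
have x0 : x = 0.
  apply/eqP; apply: contraT => /(pos x Ax Bx).
  have : dotv x (H *m x + (A^T *m u + B^T *m v)) = 0 by rewrite Hx dotv0r.
  have tr p (C : 'M[R]_(p, d)) y : C *m x = 0 -> dotv x (C^T *m y) = 0.
    by move=> Cx; rewrite /dotv mulmxA -trmx_mul Cx trmx0 mul0mx mxE.
  by rewrite !dotvDr !tr// !addr0 => ->; rewrite ltxx.
move: Hx; rewrite x0 mulmx0 add0r => /free[-> ->].
by rewrite !col_mx0.
Qed.

Lemma unitmx_solve (R : realType) n (M : 'M[R]_n) (b : 'cV[R]_n) :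
  M \in unitmx -> exists! w, M *m w = b.
Proof.
move=> uM; exists (invmx M *m b); split; first by rewrite mulKVmx.
by move=> w <-; rewrite mulKmx.
Qed.

Lemma minval_argmin (R : realType) (T : Type) (F : T -> R) (Z : set T) z :
  argmin F Z z -> minval F Z = F z.
Proof.
move=> [Zz zmin]; apply/eqP; rewrite eq_le; apply/andP; split.
  apply: ge_inf; last by exists z.
  by exists (F z) => _ [y Zy <-]; exact: zmin.
apply: lb_le_inf; first by exists (F z), z.
by move=> _ [y Zy <-]; exact: zmin.
Qed.

(** * The expansion *)

Lemma allgradT_mul (R : realType) d m (g : 'I_m -> 'cV[R]_d -> R) z
    (lam : 'cV[R]_m) :
  allgradT g z *m lam = \sum_k lam k 0 *: grad (g k) z.
Proof.
apply/colP => l; rewrite mxE summxE.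
by apply: eq_bigr => k _; rewrite !mxE mulrC.
Qed.

Lemma grad_dlag_joint (R : realType) (d m m' : nat) (f0 fj : 'cV[R]_d -> R)
    (g0 gj : 'I_m -> 'cV[R]_d -> R) (h : 'I_m' -> 'cV[R]_d -> R) z lam nu :
  C2 f0 -> C2 fj -> (forall k, C2 (g0 k)) -> (forall k, C2 (gj k)) ->
  (forall k, C2 (h k)) ->
  grad (dlag f0 fj (joint g0 h) (joint gj h) (col_mx lam nu)) z =
  cost_shift f0 fj g0 gj z lam.
Proof.
move=> Cf0 Cfj Cg0 Cgj Ch.
have Cj i : C2 (fun z => joint gj h i z - joint g0 h i z).
  case: (split_ordP i) => k ->; rewrite !jointE.
    exact: (C2B (Cgj k) (Cg0 k)).
  exact: (C2B (Ch k) (Ch k)).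
have -> := grad_lin_sum (index_enum 'I_(m + m'))
  (fun i => (col_mx lam nu) i 0) z (C2B Cfj Cf0) Cj.
rewrite (gradB _ Cfj Cf0) /cost_shift mulmxBl !allgradT_mul -sumrB; congr (_ + _).
rewrite big_split_ord /= [X in _ + X]big1 ?addr0 => [|k _]; last first.
  by rewrite !jointE (gradB _ (Ch k) (Ch k)) subrr scaler0.
apply: eq_bigr => k _.
by rewrite !jointE (gradB _ (Cgj k) (Cg0 k)) col_mxEu scalerBr.
Qed.

Lemma value2_joint (R : realType) (d m m' : nat) (f0 fj : 'cV[R]_d -> R)
    (g0 gj : 'I_m -> 'cV[R]_d -> R) (h : 'I_m' -> 'cV[R]_d -> R) z0 lam nu
    (dz : 'cV[R]_d) t :
  C2 f0 -> C2 fj -> (forall k, C2 (g0 k)) -> (forall k, C2 (gj k)) ->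
  (forall k, C2 (h k)) ->
  value2 f0 fj (joint g0 h) (joint gj h) z0 (col_mx lam nu) dz t =
  (1 - t) * f0 z0 + t * fj z0 + t * dotv lam (allvalv gj z0 - allvalv g0 z0)
  + 2^-1 * t ^+ 2 * (dotv dz (hess (lagrangian f0 g0 h lam nu) z0 *m dz)
                     + 2 * dotv dz (cost_shift f0 fj g0 gj z0 lam)).
Proof.
move=> Cf0 Cfj Cg0 Cgj Ch.
rewrite /value2 -joint_lagE (grad_dlag_joint _ _ _ Cf0 Cfj Cg0 Cgj Ch).
rewrite /dlag big_split_ord /=.
rewrite [X in _ + (_ + X)]big1 ?addr0 => [|k _]; last first.
  by rewrite !jointE subrr mulr0.
rewrite (_ : \sum_i _ = dotv lam (allvalv gj z0 - allvalv g0 z0)); last first.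
  by rewrite dotvE; apply: eq_bigr => k _; rewrite !jointE col_mxEu !mxE.
by field.
Qed.

Lemma near_right_interval (R : realType) (a : R) : 0 < a ->
  \forall t \near (0 : R)^'+, 0 <= t < a /\ 0 <= t <= 1.
Proof.
move=> a0; near=> t; have t0 : 0 < t by [].
have ta : t < a by near: t; exact: nbhs_right_lt.
have t1 : t <= 1 by near: t; exact: nbhs_right_le.
by rewrite ta t1 (ltW t0).
Unshelve. all: by end_near. Qed.

(** The expansion for arbitrary [C2] data; conditional means enter the theorem
    below only as the functions of [z] that they define. *)
Theorem program_expansion (R : realType) (d m m' s s' : nat)
    (f0 fj : 'cV[R]_d -> R) (g0 gj : 'I_m -> 'cV[R]_d -> R)
    (h : 'I_m' -> 'cV[R]_d -> R)
    (z0 : 'cV[R]_d) (lam0 : 'cV[R]_m) (nu0 : 'cV[R]_m') (zj : R -> 'cV[R]_d) :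
  let Z := feasible s s' g0 gj h in
  let ft := interp f0 fj in
  let v t := minval (ft t) (Z t) in
  (forall t, 0 <= t <= 1 -> argmin (ft t) (Z t) !=set0 ->
     argmin (ft t) (Z t) (zj t)) ->
  (forall k, C2 (h k)) -> C2 f0 -> C2 fj ->
  (forall k, C2 (g0 k)) -> (forall k, C2 (gj k)) ->
  argmin f0 (Z 0) z0 -> (forall z, argmin f0 (Z 0) z -> z = z0) ->
  inf_compact s s' f0 fj g0 gj h ->
  lagrange_multiplier s s' f0 g0 h z0 lam0 nu0 ->
  (forall lam nu, lagrange_multiplier s s' f0 g0 h z0 lam nu ->
     lam = lam0 /\ nu = nu0) ->
  strict_complementarity s s' g0 h z0 lam0 nu0 ->
  second_order_sufficient s s' f0 g0 h z0 lam0 nu0 ->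
  let H := hess (lagrangian f0 g0 h lam0 nu0) z0 in
  let Kg := active_set s g0 z0 in
  let Kh := active_set s' h z0 in
  let M := kkt_matrix H (gradmx Kg g0 z0) (gradmx Kh h z0) in
  let q := cost_shift f0 fj g0 gj z0 lam0 in
  let rhs := col_mx (- q)
               (col_mx (- (valv Kg gj z0 - valv Kg g0 z0)) 0) in
  [/\ \forall t \near 0^'+, argmin (ft t) (Z t) !=set0,
      exists! w, M *m w = rhs &
      forall (dz : 'cV[R]_d) (xi : 'cV[R]_#|Kg|) (eta : 'cV[R]_#|Kh|),
        M *m col_mx dz (col_mx xi eta) = rhs ->
        v = (fun t : R =>
               (1 - t) * f0 z0 + t * fj z0
               + t * dotv lam0 (allvalv gj z0 - allvalv g0 z0)
               + 2^-1 * t ^+ 2 * (dotv dz (H *m dz) + 2 * dotv dz q))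
            +o_ (0^'+) (fun t : R => t ^+ 2)
        /\
        zj = (fun t : R => z0 + t *: dz) +o_ (0^'+) (fun t : R => t)].
Proof.
move=> Z ft v zjP Ch Cf0 Cfj Cg0 Cgj [Zz0 z0min] z0uniq.
move=> [alpha [t0 [t0_gt0 lev bnd]]].
move=> [gL0 glam hnu] mult_uniq [scg sch] sosc H Kg Kh M q rhs.
pose c0 := joint g0 h; pose c1 := joint gj h; pose lam := col_mx lam0 nu0.
pose E := joint (fun k : 'I_m => (k < s)%N) (fun k : 'I_m' => (k < s')%N).
have ZE t : Z t = feas c0 c1 E t by rewrite joint_feasE.
have Cc0 i : C2 (c0 i).
  rewrite /c0; case: (split_ordP i) => k ->; rewrite jointE; first exact: Cg0.
  exact: Ch.
have Cc1 i : C2 (c1 i).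
  rewrite /c1; case: (split_ordP i) => k ->; rewrite jointE; first exact: Cgj.
  exact: Ch.
have actl k : active c0 E z0 (lshift m' k) = (k \in Kg).
  by rewrite joint_activeE jointE.
have actr k : active c0 E z0 (rshift m k) = (k \in Kh).
  by rewrite joint_activeE jointE.
have gL : grad (lag f0 c0 lam) z0 = 0 by rewrite -joint_lagE.
have HE : hess (lag f0 c0 lam) z0 = H by rewrite -joint_lagE.
have lam_inactive i : ~~ active c0 E z0 i -> lam i 0 = 0.
  rewrite /lam; case: (split_ordP i) => k ->; rewrite ?actl ?actr in_active_set.
    rewrite col_mxEu negb_or -leqNgt => /andP[/glam[_ /eqP]].
    by rewrite mulf_eq0 => /orP[/eqP//|->].
  rewrite col_mxEd negb_or -leqNgt => /andP[/hnu[_ /eqP]].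
  by rewrite mulf_eq0 => /orP[/eqP//|->].
have lam_pos i : ~~ E i -> active c0 E z0 i -> 0 < lam i 0.
  rewrite /lam /E; case: (split_ordP i) => k ->; rewrite ?actl ?actr !jointE.
    rewrite col_mxEu => nE /setUP[|/scg//]; by rewrite inE (negbTE nE).
  rewrite col_mxEd => nE /setUP[|/sch//]; by rewrite inE (negbTE nE).
have pos x : (forall k, k \in Kg -> dotv x (grad (g0 k) z0) = 0) ->
    (forall k, k \in Kh -> dotv x (grad (h k) z0) = 0) -> x != 0 ->
    0 < dotv x (H *m x).
  by move=> xg xh; exact: (sosc x (conj xg xh)).
have definite x : jac c0 E z0 *m x = 0 -> x != 0 ->
    0 < dotv x (hess (lag f0 c0 lam) z0 *m x).
  rewrite HE => /colP Jx; apply: pos => k kK; rewrite dotvC.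
    by have := Jx (lshift m' k); rewrite jacE actl kK /c0 jointE mxE.
  by have := Jx (rshift m k); rewrite jacE actr kK /c0 jointE mxE.
have ker : forall y : 'cV[R]_(m + m'), (jac c0 E z0)^T *m y = 0 ->
    forall i, active c0 E z0 i -> y i 0 = 0.
  apply: (unique_multiplier_licq Cf0 Cc0 gL lam_inactive lam_pos).
  move=> l gl l0 lpos; rewrite -[l]vsubmxK /lam.
  have lE k : usubmx l k 0 = l (lshift m' k) 0 by rewrite mxE.
  have rE k : dsubmx l k 0 = l (rshift m k) 0 by rewrite mxE.
  have [|-> ->//] := mult_uniq (usubmx l) (dsubmx l).
  split=> [|k sk|k sk].
  - by rewrite joint_lagE vsubmxK.
  - rewrite lE; split; first by apply: lpos; rewrite /E jointE -leqNgt.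
    have [->|gk] := eqVneq (g0 k z0) 0; first by rewrite mulr0.
    suff -> : l (lshift m' k) 0 = 0 by rewrite mul0r.
    by apply: l0; rewrite actl in_active_set (negbTE gk) orbF -leqNgt.
  - rewrite rE; split; first by apply: lpos; rewrite /E jointE -leqNgt.
    have [->|hk] := eqVneq (h k z0) 0; first by rewrite mulr0.
    suff -> : l (rshift m k) 0 = 0 by rewrite mul0r.
    by apply: l0; rewrite actr in_active_set (negbTE hk) orbF -leqNgt.
have [N licq] := partial_right_inverse ker.
have uM : M \in unitmx.
  apply: kkt_unit => [x Ax Bx|u w uw].
    apply: pos => k kK; rewrite dotvC.
      have /colP/(_ (enum_rank_in kK k)) := Ax.
      by rewrite gradmx_mul (enum_rankK_in kK kK) [RHS]mxE.
    have /colP/(_ (enum_rank_in kK k)) := Bx.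
    by rewrite gradmx_mul (enum_rankK_in kK kK) [RHS]mxE.
  have yK := ker (col_mx (spread u) (spread w)).
  rewrite joint_trmx_jac uw in yK; have {}yK := yK erefl.
  split; apply/colP => i; rewrite [RHS]mxE.
    have := yK (lshift m' (enum_val i)).
    by rewrite actl enum_valP col_mxEu spread_enum => /(_ isT).
  have := yK (rshift m (enum_val i)).
  by rewrite actr enum_valP col_mxEd spread_enum => /(_ isT).
have [B bndB] : exists B, forall t z, 0 <= t < t0 -> Z t z ->
    ft t z <= alpha -> `|z| <= B.
  have [B [_ BP]] := bnd; exists (B + 1) => t z tt Zz fz.
  apply: (BP (B + 1)); first by rewrite ltrDl.
  exact: (ex_intro2 _ _ t tt (conj Zz fz)).
have near_t0 := near_right_interval t0_gt0.
have argmin_ex t : 0 <= t < t0 -> argmin (ft t) (Z t) !=set0.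
  move=> tt; have := lev t tt; have := bndB t; rewrite /= -/(Z t) ZE => bt lt.
  by apply: (argmin_exists Cf0 Cfj Cc0 Cc1 lt) => z fz zl; exact: bt.
split.
- by apply: filterS near_t0 => t [/argmin_ex].
- exact: unitmx_solve.
move=> dz xi eta; rewrite kkt_mulE => /eq_col_mx[Hdz /eq_col_mx[Adz Bdz]].
have jac_dz : jac c0 E z0 *m dz = - cshift c0 c1 E z0.
  apply/colP => i; rewrite jacE !mxE; case: (split_ordP i) => k ->.
    rewrite actl /c0 /c1 !jointE; case: ifPn => kK; last by rewrite oppr0.
    have /colP/(_ (enum_rank_in kK k)) := Adz.
    by rewrite gradmx_mul (enum_rankK_in kK kK) !mxE (enum_rankK_in kK kK).
  rewrite actr /c0 /c1 !jointE; case: ifPn => kK; last by rewrite oppr0.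
  rewrite subrr oppr0.
  have /colP/(_ (enum_rank_in kK k)) := Bdz.
  by rewrite gradmx_mul (enum_rankK_in kK kK) [RHS]mxE.
have stat : hess (lag f0 c0 lam) z0 *m dz + grad (dlag f0 fj c0 c1 lam) z0 =
    - ((jac c0 E z0)^T *m col_mx (spread xi) (spread eta)).
  rewrite HE (grad_dlag_joint _ _ _ Cf0 Cfj Cg0 Cgj Ch) joint_trmx_jac -/q.
  by apply/eqP; rewrite -addr_eq0 addrAC Hdz addNr.
have z0_unique z : feas c0 c1 E 0 z -> f0 z <= f0 z0 -> z = z0.
  rewrite -ZE => Zz fz; apply: z0uniq; split; first exact: Zz.
  by move=> y Zy; exact: le_trans fz (z0min y Zy).
have feas0 : feas c0 c1 E 0 z0 by rewrite -ZE.
have main := perturbed_minimizer_expansion Cf0 Cfj Cc0 Cc1 feas0 jac_dz gL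
  lam_inactive lam_pos definite stat licq z0_unique B.
have {}main e : 0 < e -> \forall t \near 0^'+,
    `|v t - value2 f0 fj c0 c1 z0 lam dz t| <= e * t ^+ 2 /\
    `|zj t - z0 - t *: dz| <= e * t.
  move=> e0; apply: filterS2 near_t0 (main e e0) => t [tt t1] mt.
  have zt := zjP t t1 (argmin_ex t tt).
  have ztB : `|zj t| <= B.
    have [y [Zy fy]] := lev t tt.
    exact: (bndB t _ tt zt.1 (le_trans (zt.2 y Zy) fy)).
  rewrite /v (minval_argmin zt); apply: mt; last exact: ztB.
  by rewrite -ZE; exact: zt.
split; apply/eqaddoP => e e0; apply: filterS (main e e0) => t [vt zt].
  rewrite (value2_joint _ _ _ _ _ Cf0 Cfj Cg0 Cgj Ch) in vt.
  by rewrite (ger0_norm (sqr_ge0 t)); exact: vt.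
rewrite -addrA -opprD in zt.
exact: le_trans zt (ler_wpM2l (ltW e0) (ler_norm t)).
Qed.

Theorem theorem6 (R : realType)
    (dT dY : measure_display) (T : measurableType dT) (Yt : measurableType dY)
    (P : probability T R) (p d m m' s s' : nat)
    (X : {RV P >-> p.-tuple R}) (Y : {RV P >-> Yt})
    (Reg : nat -> set (p.-tuple R))
    (c : 'cV[R]_d -> Yt -> R) (G : 'I_m -> 'cV[R]_d -> Yt -> R)
    (h : 'I_m' -> 'cV[R]_d -> R) (j : nat)
    (z0 : 'cV[R]_d) (lam0 : 'cV[R]_m) (nu0 : 'cV[R]_m') (zj : R -> 'cV[R]_d) :
  (s <= m)%N -> (s' <= m')%N -> j = 1%N \/ j = 2%N ->
  Reg 0%N = Reg 1%N `|` Reg 2%N -> Reg 1%N `&` Reg 2%N = set0 ->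
  (forall i, (i <= 2)%N -> measurable (Reg i)) ->
  (forall i, (i <= 2)%N -> (0 < P (X @^-1` Reg i))%E) ->
  (forall i z, (i <= 2)%N ->
     P.-integrable (X @^-1` Reg i) (fun w => (c z (Y w))%:E)) ->
  (forall i k z, (i <= 2)%N ->
     P.-integrable (X @^-1` Reg i) (fun w => (G k z (Y w))%:E)) ->
  let f i z := cond_mean P (X @^-1` Reg i) (fun w => c z (Y w)) in
  let g i k z := cond_mean P (X @^-1` Reg i) (fun w => G k z (Y w)) in
  let Z := feasible s s' (g 0%N) (g j) h in
  let ft := interp (f 0%N) (f j) in
  let v t := minval (ft t) (Z t) in
  (forall t, 0 <= t <= 1 -> argmin (ft t) (Z t) !=set0 ->
     argmin (ft t) (Z t) (zj t)) ->
  (forall k, C2 (h k)) ->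
  C2 (f 0%N) -> C2 (f j) ->
  (forall k, C2 (g 0%N k)) -> (forall k, C2 (g j k)) ->
  argmin (f 0%N) (Z 0) z0 -> (forall z, argmin (f 0%N) (Z 0) z -> z = z0) ->
  inf_compact s s' (f 0%N) (f j) (g 0%N) (g j) h ->
  lagrange_multiplier s s' (f 0%N) (g 0%N) h z0 lam0 nu0 ->
  (forall lam nu, lagrange_multiplier s s' (f 0%N) (g 0%N) h z0 lam nu ->
     lam = lam0 /\ nu = nu0) ->
  strict_complementarity s s' (g 0%N) h z0 lam0 nu0 ->
  mangasarian_fromovitz s s' (g 0%N) h z0 ->
  second_order_sufficient s s' (f 0%N) (g 0%N) h z0 lam0 nu0 ->
  let H := hess (lagrangian (f 0%N) (g 0%N) h lam0 nu0) z0 in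
  let Kg := active_set s (g 0%N) z0 in
  let Kh := active_set s' h z0 in
  let M := kkt_matrix H (gradmx Kg (g 0%N) z0) (gradmx Kh h z0) in
  let q := cost_shift (f 0%N) (f j) (g 0%N) (g j) z0 lam0 in
  let rhs := col_mx (- q)
               (col_mx (- (valv Kg (g j) z0 - valv Kg (g 0%N) z0)) 0) in
  [/\ \forall t \near 0^'+, argmin (ft t) (Z t) !=set0,
      exists! w, M *m w = rhs &
      forall (dz : 'cV[R]_d) (xi : 'cV[R]_#|Kg|) (eta : 'cV[R]_#|Kh|),
        M *m col_mx dz (col_mx xi eta) = rhs ->
        v = (fun t : R =>
               (1 - t) * f 0%N z0 + t * f j z0
               + t * dotv lam0 (allvalv (g j) z0 - allvalv (g 0%N) z0)
               + 2^-1 * t ^+ 2 * (dotv dz (H *m dz) + 2 * dotv dz q))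
            +o_ (0^'+) (fun t : R => t ^+ 2)
        /\
        zj = (fun t : R => z0 + t *: dz) +o_ (0^'+) (fun t : R => t)].
Proof.
move=> _ _ _ _ _ _ _ _ _ f g Z ft v zjP Ch Cf0 Cfj Cg0 Cgj z0P z0uniq icpt
  mult uniq strict _ sosc.
exact: program_expansion zjP Ch Cf0 Cfj Cg0 Cgj z0P z0uniq icpt mult uniq
  strict sosc.
Qed.
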